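(* On the level $(1,N)$ representations $\mathcal F^{(1,N)}_\bullet$, the type I and type II dual vertex operators satisfy, for all $n\ge0$, all $\lambda,\mu\in\mathcal P_n$ (partitions of $n$) and $u,v\in\mathbb C^\times$, $$\Phi_\lambda(u)\Psi^*_\mu(v)=\chi(u/v)\,\Psi^*_\mu(v)\Phi_\lambda(u),\qquad \chi(u)=\frac1{\Gamma(\hbar^{1/2}u;t_1,t_2)}=\Gamma(\hbar^{1/2}/u;t_1,t_2),$$ where $\Gamma(z;t_1,t_2)=\frac{(t_1t_2/z;t_1,t_2)_\infty}{(z;t_1,t_2)_\infty}$ and $(z;t_1,t_2)_\infty=\prod_{m_1,m_2\ge0}(1-zt_1^{m_1}t_2^{m_2})$.
   Context: Parameters: $t_1,t_2,p$ are generic complex numbers, $\hbar=t_1t_2$, $p^*=p\hbar^{-1}$, $|t_1|,|t_2|,|p|,|p^*|<1$. $\kappa_m=-(1-t_1^m)(1-t_2^m)(1-\hbar^{-m})$, $(z;p)_\infty=\prod_{n\ge 0}(1-zp^n)$, $(a_1,\dots,a_M;p)_\infty=\prod_i(a_i;p)_\infty$, $\theta(z)=-z^{-1/2}(z;p)_\infty(p/z;p)_\infty$, $\theta^*=\theta|_{p\to p^*}$. Zero modes $c,\Lambda_0,h,\alpha,P,Q$ satisfy $[c,\Lambda_0]=[h,\alpha]=[P,Q]=1$, all other commutators $0$; $\mathfrak z^*=\hbar^P$, $\mathfrak z=\hbar^{P-c}$. Heisenberg generators $\alpha_m$ ($m\ne0$), commuting with zero modes: $[\alpha_m,\alpha_n]=-\frac{\kappa_m}{m}(1-\hbar^{-m})\frac{1-p^m}{1-p^{*m}}\delta_{m+n,0}$,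 $\alpha'_m=\frac{1-p^{*m}}{1-p^m}\hbar^{m/2}\alpha_m$. The Fock space $\mathcal F^{(1,N)}_v$: polynomials in $\alpha_{-m}$ ($m>0$) on a vacuum killed by $\alpha_m$ ($m>0$), on which $e^h=v$, $c=N$, tensored with $e^{kQ}$, $k\in\mathbb Z$. Put $x^+(z)=e^{h}(\hbar^{1/2}/z)^{-c}\exp\{-\sum_{n>0}\frac{\hbar^{n/2}}{1-\hbar^n}\alpha_{-n}z^n\}\exp\{\sum_{n>0}\frac{\hbar^{n/2}}{1-\hbar^n}\alpha_nz^{-n}\}$, $x^-(z)=e^{-h}(\hbar^{1/2}/z)^{c}\exp\{\sum_{n>0}\frac{\hbar^{n/2}}{1-\hbar^n}\alpha'_{-n}z^n\}\exp\{-\sum_{n>0}\frac{\hbar^{n/2}}{1-\hbar^n}\alpha'_nz^{-n}\}$, $\Phi_\emptyset(u)=(-u)^{-\alpha}e^{\Lambda_0}\exp\{-\sum_{m>0}\frac1{\kappa_m}\alpha'_{-m}(\hbar^{1/2}u)^m\}\exp\{\sum_{m>0}\frac1{\kappa_m}\alpha'_m(\hbar^{1/2}u)^{-m}\}$, $\Psi^*_\emptyset(u)=(-u)^{\alpha}e^{-\Lambda_0-Q}\exp\{\sum_{m>0}\frac1{\kappa_m}\alpha_{-m}(\hbar^{1/2}u)^m\}\exp\{-\sum_{m>0}\frac1{\kappa_m}\alpha_m(\hbar^{1/2}u)^{-m}\}$. Colons denote normal ordering ($\alpha_{-m},\alpha,\Lambda_0,Q$ left of $\alpha_m,h,c$).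 Products of operators are a scalar coefficient times a normal ordered product and identities are understood after meromorphic continuation of the scalar coefficients (of the integrands). Put $\langle x^-(u)x^-(v)\rangle^{sym}=t_1^{-1}\frac{(pt_1^{-1}v/u,\,pt_1^{-1}u/v,\,\hbar v/u,\,\hbar u/v;p)_\infty}{(pv/u,\,pu/v,\,t_2v/u,\,t_2u/v;p)_\infty}$, $\langle x^+(u)x^+(v)\rangle^{sym}=t_1^{-1}\frac{(p^*t_2v/u,\,p^*t_2u/v,\,v/u,\,u/v;p^* )_\infty}{(p^*\hbar v/u,\,p^*\hbar u/v,\,v/t_1u,\,u/t_1v;p^* )_\infty}$. For a box $a=(i,j)$ of a partition, $\rho_a=(i-j)-\epsilon(i+j-2)$, $0<\epsilon\ll1$. For $\lambda\in\mathcal P_n$, $\mathrm{Stab}(\lambda;\mathfrak z)$ is the Aganagic–Okounkov elliptic stable envelope of the fixed point $\lambda$ of $\mathrm{Hilb}^n(\mathbb C^2)$ (chamber $t_1/t_2>0$, framing weight $u$, Kähler parameter $\mathfrak z$, nome $p$), a symmetric meromorphic function of the Chern roots $x_a$ ($a\in\lambda$). $\widehat{\mathrm{Stab}}(\lambda;\mathfrak z)$ is $\mathrm{Stab}(\lambda;\mathfrak z)$ divided by $(-1)^{\#\{a:\rho_a>0\}}\prod_{a\ne b}\frac{\theta(t_1x_a/x_b)}{\theta(x_a/x_b)}\prod_a\theta(x_a/u)$, and $\widehat{\mathrm{Stab}}^*(\lambda;\mathfrak z^{*-1})$ is $\mathrm{Stab}(\lambda;\mathfrak z)|_{p\to p^*,\mathfrak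 z\to\mathfrak z^{*-1}}$ divided by $(-1)^{\#\{a:\rho_a\le0\}}\prod_{a\ne b}\frac{\theta^*(t_2x_a/x_b)}{\theta^*(\hbar x_a/x_b)}\prod_a\theta^*(\hbar u/x_a)$. The vertex operator components are $$\Phi_\lambda(u)=\int_{\mathcal C}\prod_{a\in\lambda}dx_a:\prod_{a\in\lambda}x^-(x_a):\Phi_\emptyset(u)\prod_{\rho_a<\rho_b}\langle x^-(x_a)x^-(x_b)\rangle^{sym}\,\widehat{\mathrm{Stab}}(\lambda;\mathfrak z),$$ $$\Psi^*_\lambda(u)=\int_{\mathcal C^*}\prod_{a\in\lambda}dx_a\ \widehat{\mathrm{Stab}}^*(\lambda;\mathfrak z^{*-1}):\prod_{a\in\lambda}x^+(x_a):\Psi^*_\emptyset(u)\prod_{\rho_a>\rho_b}\langle x^+(x_a)x^+(x_b)\rangle^{sym},$$ with $\mathfrak z$ placed rightmost, $\mathfrak z^*$ leftmost, and fixed integration cycles $\mathcal C,\mathcal C^*$ (e.g. tori $|x_a|=1$, or Jackson integrals). A product of integrals is the integral of the product of integrands. *)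

(* Defs.v *)
From HB Require Import structures.
From mathcomp Require Import all_boot all_order all_algebra all_fingroup.
From mathcomp Require Import all_classical all_reals all_analysis.
From mathcomp Require Import complex.

Set Implicit Arguments.
Unset Strict Implicit.
Unset Printing Implicit Defensive.
Import Order.TTheory GRing.Theory Num.Theory.
Import numFieldNormedType.Exports.

Local Open Scope classical_set_scope.
Local Open Scope ring_scope.

Section ComplexAnalysis.
Variable R : realType.
Local Notation C := R[i].

(* [R[i]] carries no topology in the libraries used here: limits are taken on
   real and imaginary parts. *)
Definition ccvg (w : nat -> C) : Prop :=
  cvgn (fun k => complex.Re (w k)) /\ cvgn (fun k => complex.Im (w k)).

Definition clim (w : nat -> C) : C :=
  (limn (fun k => complex.Re (w k)) +i* limn (fun k => complex.Im (w k)))%C.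

(* sum over the modes m >= 1 *)
Definition modesum (f : nat -> C) : C :=
  clim (fun M => \sum_(1 <= m < M) f m).

Definition cexp (z : C) : C :=
  (expR (complex.Re z) * cos (complex.Im z)
     +i* (expR (complex.Re z) * sin (complex.Im z)))%C.

Definition qpoch (z p : C) : C := clim (fun k => \prod_(i < k) (1 - z * p ^+ i)).

Definition qpochs (s : seq C) (p : C) : C := \prod_(z <- s) qpoch z p.

Definition qpoch2 (z t1 t2 : C) : C :=
  clim (fun k => \prod_(i < k) \prod_(j < k) (1 - z * t1 ^+ i * t2 ^+ j)).

Definition Gam (z t1 t2 : C) : C := qpoch2 (t1 * t2 / z) t1 t2 / qpoch2 z t1 t2.

(* [thetah s p] is theta(z) = - z^(-1/2) (z;p) (p/z;p) at z = s^2: the argument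
   is the square root s that z^(1/2) refers to. *)
Definition thetah (s p : C) : C :=
  - s^-1 * qpoch (s ^+ 2) p * qpoch (p / s ^+ 2) p.

Definition entire (f : C -> C) : Prop :=
  exists c : nat -> C, forall z : C,
    ccvg (fun M => \sum_(k < M) c k * z ^+ k) /\
    f z = clim (fun M => \sum_(k < M) c k * z ^+ k).

(* A meromorphic function on the complex plane, as a total function with value
   0 at its poles. *)
Definition meromorphic (f : C -> C) : Prop :=
  exists g h : C -> C,
    [/\ entire g, entire h, exists z, h z != 0,
        forall z, (g z != 0) || (h z != 0) & forall z, f z = g z / h z].

End ComplexAnalysis.

Section Setup.
Variable R : realType.
Local Notation C := R[i].

(* [r1], [r2] are the square roots of t1, t2 used in all half-integer powers;
   [zeta] is the value of hbar^(P/2) on the vectors with k = 0, so that P acts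
   on e^(kQ) as s + k with s an arbitrary complex number. *)
Record params := Params { r1 : C; r2 : C; pp : C; zeta : C }.

Variable A : params.

Definition t1 : C := r1 A ^+ 2.
Definition t2 : C := r2 A ^+ 2.
Definition hbar : C := t1 * t2.
Definition hbarh : C := r1 A * r2 A.
Definition pstar : C := pp A / hbar.

Definition generic : Prop :=
  [/\ [/\ t1 != 0, t2 != 0, pp A != 0 & zeta A != 0],
      [/\ `|t1| < 1, `|t2| < 1, `|pp A| < 1 & `|pstar| < 1] &
      forall i j k : int, t1 ^ i * t2 ^ j * pp A ^ k = 1 ->
        [/\ i = 0, j = 0 & k = 0]].

Definition kappa (m : int) : C :=
  - ((1 - t1 ^ m) * (1 - t2 ^ m) * (1 - hbar ^ (- m))).

Definition chi (z : C) : C := (Gam (hbarh * z) t1 t2)^-1.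

(* neither chi(z) nor 1/chi(z) has a pole at z *)
Definition chi_regular (z : C) : Prop :=
  forall i j : nat, hbarh * z * t1 ^+ i * t2 ^+ j != 1 /\
                    hbarh / z * t1 ^+ i * t2 ^+ j != 1.

(* [alpha_m, alpha_(-m)] *)
Definition heis (m : nat) : C :=
  - (kappa m / m%:R) * (1 - hbar ^- m) * ((1 - pp A ^+ m) / (1 - pstar ^+ m)).

(* alpha'_m = prim m * alpha_m *)
Definition prim (m : int) : C :=
  (1 - pstar ^ m) / (1 - pp A ^ m) * hbarh ^ m.

(* The summand of the zero mode space with c = level, e^h = eh, spanned by
   e^(kQ) with k = eQ. *)
Record sector := Sector { level : int; eh : C; eQ : int }.

(* The vector [vec] is a function of the variables a_m = alpha_(-m), m >= 1:
   alpha_(-m) acts as multiplication by a_m and alpha_m as heis m * d/da_m,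
   the vacuum being the constant 1. *)
Record state := State { sec : sector; vec : (nat -> C) -> C }.

Inductive fock_poly : ((nat -> C) -> C) -> Prop :=
| fock_const (k : C) : fock_poly (fun=> k)
| fock_var (m : nat) : (0 < m)%N -> fock_poly (fun a => a m)
| fock_add f g : fock_poly f -> fock_poly g -> fock_poly (fun a => f a + g a)
| fock_mul f g : fock_poly f -> fock_poly g -> fock_poly (fun a => f a * g a).

Definition finsupp (a : nat -> C) : Prop :=
  exists M, forall m, (M <= m)%N -> a m = 0.

(* homogeneous vectors of the spaces F^(1,N)_v tensored with e^(kQ) *)
Definition fock_vector (s : state) : Prop :=
  eh (sec s) != 0 /\ fock_poly (vec s).

(* Exponentials of creation operators map polynomials to power series in
   infinitely many a_m; these are determined by their values at finitely
   supported points. *)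
Definition state_eq (s s' : state) : Prop :=
  sec s = sec s' /\ forall a, finsupp a -> vec s a = vec s' a.

Definition scale (k : C) (s : state) : state :=
  State (sec s) (fun a => k * vec s a).

(* The normal ordered operator
     exp(sum_m cre m alpha_(-m)) base^alpha e^(lam Lambda_0 + qq Q)
          * exp(sum_m ann m alpha_m) e^(hh h) cbase^c. *)
Record nop := Nop {
  cre : nat -> C; base : C; lam : int; qq : int;
  ann : nat -> C; hh : int; cbase : C }.

(* exp(ann m alpha_m) = exp(ann m * heis m * d/da_m) is a translation of a_m;
   [h, alpha] = [c, Lambda_0] = [P, Q] = 1 give the changes of sector. *)
Definition sec_act (o : nop) (x : sector) : sector :=
  Sector (level x + lam o) (eh x * base o) (eQ x + qq o).

Definition act (o : nop) (s : state) : state :=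
  State (sec_act o (sec s))
    (fun a => eh (sec s) ^ hh o * cbase o ^ level (sec s)
       * cexp (modesum (fun m => cre o m * a m))
       * vec s (fun m => a m + ann o m * heis m)).

Definition nid : nop := Nop (fun=> 0) 1 0 0 (fun=> 0) 0 1.

Definition nmul (o o' : nop) : nop :=
  Nop (fun m => cre o m + cre o' m) (base o * base o')
      (lam o + lam o') (qq o + qq o')
      (fun m => ann o m + ann o' m) (hh o + hh o') (cbase o * cbase o').

Inductive kind := Xminus | Xplus | Phi0 | Psi0.

Definition current (k : kind) (z : C) : nop :=
  match k with
  | Xplus =>
      Nop (fun m => - (hbarh ^+ m / (1 - hbar ^+ m)) * z ^+ m) 1 0 0
          (fun m => hbarh ^+ m / (1 - hbar ^+ m) * z ^- m) 1 (hbarh / z)^-1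
  | Xminus =>
      Nop (fun m => hbarh ^+ m / (1 - hbar ^+ m) * prim (- m%:Z) * z ^+ m) 1 0 0
          (fun m => - (hbarh ^+ m / (1 - hbar ^+ m)) * prim m * z ^- m)
          (-1) (hbarh / z)
  | Phi0 =>
      Nop (fun m => - (kappa m)^-1 * prim (- m%:Z) * (hbarh * z) ^+ m)
          (- z)^-1 1 0
          (fun m => (kappa m)^-1 * prim m * (hbarh * z) ^- m) 0 1
  | Psi0 =>
      Nop (fun m => (kappa m)^-1 * (hbarh * z) ^+ m)
          (- z) (-1) (-1)
          (fun m => - (kappa m)^-1 * (hbarh * z) ^- m) 0 1
  end.

(* [f (w / z)] is the coefficient in k(z) k'(w) = f(w/z) :k(z) k'(w): ,
   where the composition converges for small w/z and f is meromorphic. By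
   homogeneity these coefficients depend on w/z only, and the identity theorem
   makes f unique. *)
Definition is_contraction (k k' : kind) (f : C -> C) : Prop :=
  meromorphic f /\
  exists2 e : C, 0 < e & forall z w : C, z != 0 -> w != 0 -> `|w / z| < e ->
    forall s : state, fock_vector s ->
      state_eq (act (current k z) (act (current k' w) s))
        (scale (f (w / z)) (act (nmul (current k z) (current k' w)) s)).

Definition contraction (k k' : kind) : C -> C :=
  xget (fun=> 0) [set f | is_contraction k k' f].

(* A product of operators, leftmost factor first. [Normal w] is the normal
   ordered product of the currents in w; [Zero g] is a function of the
   commuting zero modes c, e^h, P, and acts on a sector by its value there. *)
Inductive factor := Zero of (sector -> C) | Normal of seq (kind * C).

Definition currents (e : seq factor) : seq (kind * C) :=
  flatten [seq (if x is Normal w then w else [::]) | x <- e].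

Definition nprod (w : seq (kind * C)) : nop :=
  foldr (fun x => nmul (current x.1 x.2)) nid w.

(* Wick's theorem: one contraction for each pair of currents that lie in
   different normal ordered factors. *)
Fixpoint wick (e : seq factor) : C :=
  match e with
  | [::] => 1
  | Zero _ :: e' => wick e'
  | Normal w :: e' =>
      (\prod_(x <- w) \prod_(y <- currents e') contraction x.1 y.1 (y.2 / x.2))
      * wick e'
  end.

Fixpoint zero_modes (e : seq factor) (x : sector) : C :=
  match e with
  | [::] => 1
  | Zero g :: e' => g (sec_act (nprod (currents e')) x) * zero_modes e' x
  | Normal _ :: e' => zero_modes e' x
  end.

Definition apply (e : seq factor) (s : state) : state :=
  scale (wick e * zero_modes e (sec s)) (act (nprod (currents e)) s).

(* square roots of the dynamical parameters hbar^(P-c) and hbar^P *)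
Definition zh (x : sector) : C := zeta A * hbarh ^ (eQ x - level x).
Definition zstarh (x : sector) : C := zeta A * hbarh ^ eQ x.

Definition xm_sym (u v : C) : C :=
  t1^-1 * qpochs [:: pp A / t1 * v / u; pp A / t1 * u / v;
                     hbar * v / u; hbar * u / v] (pp A)
  / qpochs [:: pp A * v / u; pp A * u / v; t2 * v / u; t2 * u / v] (pp A).

Definition xp_sym (u v : C) : C :=
  t1^-1 * qpochs [:: pstar * t2 * v / u; pstar * t2 * u / v; v / u; u / v] pstar
  / qpochs [:: pstar * hbar * v / u; pstar * hbar * u / v;
               v / (t1 * u); u / (t1 * v)] pstar.

End Setup.

Definition is_partition (n : nat) (la : seq nat) : bool :=
  [&& sorted geq la, 0%N \notin la & sumn la == n].

Definition boxes (la : seq nat) : seq (nat * nat) :=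
  [seq (i.+1, j.+1) | i <- iota 0 (size la), j <- iota 0 (nth 0%N la i)].

(* The Chern roots of a partition of n are indexed by 'I_n, the index a
   standing for the box [box la a]. *)
Definition box (la : seq nat) (a : nat) : nat * nat := nth (0%N, 0%N) (boxes la) a.

(* For boxes of a partition of n, i + j - 2 < n, so that all epsilon in
   (0, 1/n) induce the same comparisons between the rho_a and the rho_a + 1. *)
Definition rho (n : nat) (la : seq nat) (a : 'I_n) : rat :=
  ((box la a).1%:R - (box la a).2%:R)
  - n.+1%:R^-1 * ((box la a).1 + (box la a).2 - 2)%N%:R.

Section Trees.
Variables (n : nat) (la : seq nat).
Implicit Types (a b c r : 'I_n) (D : {set 'I_n}).
Local Notation bx := (box la).

Definition is_root r : bool := bx r == (1%N, 1%N).

Definition inner : {set 'I_n} := [set a : 'I_n | (1 < (bx a).1)%N && (1 < (bx a).2)%N].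

Definition adjacent a b : bool :=
  [|| bx b == ((bx a).1.+1, (bx a).2), bx b == ((bx a).1, (bx a).2.+1),
      bx a == ((bx b).1.+1, (bx b).2) | bx a == ((bx b).1, (bx b).2.+1)].

(* Each inner box c = (i,j) closes the path (i-1,j-1) - (i,j-1) - (i,j); the
   tree of D misses its first edge if c is in D, its second edge otherwise. *)
Definition cut D a b : bool :=
  [exists c : 'I_n, (c \in inner) &&
    (let: (i, j) := bx c in
     if c \in D then (bx a == (i.-1, j.-1)) && (bx b == (i, j.-1))
     else (bx a == (i, j.-1)) && (bx b == (i, j)))].

Definition tree D a b : bool := [&& adjacent a b, ~~ cut D a b & ~~ cut D b a].

(* the boxes whose path from the root passes through b, b included *)
Definition subtree D b : {set 'I_n} :=
  [set c | [forall r, is_root r ==>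
    (r == b) || ~~ connect (fun x y => [&& tree D x y, x != b & y != b]) r c]].

Definition parent D a b : bool := tree D a b && (a \notin subtree D b).

(* edges directed towards the corner (1,1) *)
Definition wrong_edges D : nat :=
  #|[pred ab : 'I_n * 'I_n | [&& parent D ab.1 ab.2,
      ((bx ab.2).1 <= (bx ab.1).1)%N & ((bx ab.2).2 <= (bx ab.1).2)%N]]|.

(* Shift of the Kaehler parameter at a; it gives all summands of the envelope
   the same quasi-periods as the polarization. *)
Definition kshift a : int :=
  ((0 < rho la a)%R : nat)%:Z
  + #|[pred b : 'I_n | (rho la a < rho la b) && (rho la b < rho la a + 1)]|%:Z
  - #|[pred b : 'I_n | (rho la a - 1 < rho la b) && (rho la b < rho la a)]|%:Z.

End Trees.

Section Stab.
Variables (R : realType) (A : params R) (n : nat) (la : seq nat).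
Local Notation C := R[i].
Local Notation q1 := (r1 A).
Local Notation q2 := (r2 A).
Local Notation rho := (@rho n la).

(* The functions of this section take square roots: [X] of the Chern roots, [U]
   of the framing weight u, [Z] of the Kaehler parameter; [p] is the nome. *)
Variables (p U Z : C).
Local Notation th s := (thetah s p).

Definition phi (x y : C) : C := th (x * y) / (th x * th y).

(* square root of the weight of the tautological bundle at a, for u = 1 *)
Definition wt (a : 'I_n) : C := q1 ^- (box la a).2.-1 * q2 ^- (box la a).1.-1.

(* The polarization u^-1 V + (t1 - 1) V^* V, each weight w being replaced by
   hbar/w when it is attracting. *)
Definition Sfac (X : 'I_n -> C) : C :=
  (\prod_a (if rho a <= 0 then th (X a / U) else th (q1 * q2 * U / X a)))
  * (\prod_a \prod_b (if rho a + 1 < rho b then th (q1 * X a / X b)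
                      else th (q2 * X b / X a)))
  / \prod_a \prod_(b | rho a < rho b) (th (X a / X b) * th (q1 * q2 * X a / X b)).

Definition Zsub (D : {set 'I_n}) (b : 'I_n) : C :=
  \prod_(c in subtree la D b) (Z * (q1 * q2) ^ kshift la c).

Definition Wfac (D : {set 'I_n}) (X : 'I_n -> C) : C :=
  (-1) ^+ wrong_edges la D
  * (\prod_(r : 'I_n | is_root la r) phi (X r / U) (Zsub D r))
  * \prod_a \prod_(b | parent la D a b)
      phi (X b * wt a / (wt b * X a)) (Zsub D b).

Definition Stabh (X : 'I_n -> C) : C :=
  \sum_(s : 'S_n) Sfac (X \o s)
     * \sum_(D : {set 'I_n} | D \subset inner n la) Wfac D (X \o s).

End Stab.

Section VertexOperators.
Variables (R : realType) (A : params R) (n : nat) (la : seq nat).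
Local Notation C := R[i].
Local Notation q1 := (r1 A).
Local Notation q2 := (r2 A).
Local Notation rho := (@rho n la).

(* The elliptic stable envelope of the fixed point la, for the chamber
   t1/t2 > 0 and the polarization of [Sfac], in Smirnov's form: a
   symmetrization over the Chern roots of a sum over trees in la. Its
   restrictions to the fixed points (x_a = u * wt a ^ 2) are triangular, and at
   la it is the product of the theta functions of the repelling tangent
   weights. [x]: Chern roots; [z2]: square root of the
   Kaehler parameter. *)
Definition Stab (p u z2 : C) (x : 'I_n -> C) : C :=
  Stabh A la p (sqrtC u) z2 (fun a => sqrtC (x a)).

(* In the quotients below the square roots of u and of the x_a only occur with
   even total exponent: the choice of [sqrtC] is immaterial. *)
Definition Stab_hat (u z2 : C) (x : 'I_n -> C) : C :=
  let th s := thetah s (pp A) in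
  let X a := sqrtC (x a) in
  Stab (pp A) u z2 x /
  ((-1) ^+ #|[pred a | (0 < rho a)%R]|
   * (\prod_a \prod_(b | b != a) (th (q1 * X a / X b) / th (X a / X b)))
   * \prod_a th (X a / sqrtC u)).

Definition Stab_hat_star (u z2 : C) (x : 'I_n -> C) : C :=
  let th s := thetah s (pstar A) in
  let X a := sqrtC (x a) in
  Stab (pstar A) u z2 x /
  ((-1) ^+ #|[pred a | rho a <= 0]|
   * (\prod_a \prod_(b | b != a) (th (q2 * X a / X b) / th (q1 * q2 * X a / X b)))
   * \prod_a th (q1 * q2 * sqrtC u / X a)).

(* integrands of Phi_la(u) and Psi^*_la(u) at the point x of the cycle *)
Definition Phi_integrand (u : C) (x : 'I_n -> C) : seq (factor R) :=
  [:: Normal [seq (Xminus, x a) | a <- enum 'I_n];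
      Normal [:: (Phi0, u)];
      Zero (fun=> \prod_a \prod_(b | rho a < rho b) xm_sym A (x a) (x b));
      Zero (fun s => Stab_hat u (zh A s) x)].

Definition Psi_integrand (u : C) (x : 'I_n -> C) : seq (factor R) :=
  [:: Zero (fun s => Stab_hat_star u (zstarh A s)^-1 x);
      Normal [seq (Xplus, x a) | a <- enum 'I_n];
      Normal [:: (Psi0, u)];
      Zero (fun=> \prod_a \prod_(b | rho a > rho b) xp_sym A (x a) (x b))].

End VertexOperators.

(* A cycle of n nonzero variables, as a parametrization [pt] of its points by a measure
   space, together with the density [jac] of dx_1 ... dx_n. The torus
   |x_a| = 1 is [0,1]^n with the Lebesgue measure, pt th a = e^(2 pi i th_a) and
   jac = prod_a 2 pi i x_a; a Jackson integral is Z^n with the counting measure,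
   pt k a = xi_a p^(k_a) and jac proportional to prod_a x_a. *)
Record integration_cycle (R : realType) (n : nat) := Cycle {
  disp : measure_display;
  dom : measurableType disp;
  meas : {sigma_finite_measure set dom -> \bar R};
  pt : dom -> 'I_n -> R[i];
  jac : dom -> R[i];
  pt_neq0 : forall w a, pt w a != 0 }.

(* the integral over the product cycle, 0 if the integrand is not integrable *)
Definition cint2 (R : realType) (n n' : nat) (C1 : integration_cycle R n) (C2 : integration_cycle R n')
    (f : ('I_n -> R[i]) -> ('I_n' -> R[i]) -> R[i]) : R[i] :=
  let mu := (meas C1 \x meas C2)%E in
  let F w := f (pt w.1) (pt w.2) * (jac w.1 * jac w.2) in
  let re w := (complex.Re (F w))%:E in
  let im w := (complex.Im (F w))%:E in
  if `[< mu.-integrable setT re /\ mu.-integrable setT im >]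
  then (fine (\int[mu]_w re w)%E +i* fine (\int[mu]_w im w)%E)%C else 0.

(* Main.v *)
Require Import Defs.
From mathcomp Require Import all_boot all_order all_algebra all_classical all_reals all_analysis.
From mathcomp Require Import complex ring lra.
Import Order.TTheory GRing.Theory Num.Theory.
Import numFieldNormedType.Exports.
Set Implicit Arguments.
Unset Strict Implicit.
Unset Printing Implicit Defensive.
Local Open Scope classical_set_scope.
Local Open Scope ring_scope.

(** Each product of two current exponentials contracts to an explicit
    meromorphic function of the ratio w / z of the arguments: the exponent
    is a sum over modes which resums, through log (1 - x) = - sum x^m / m, to
    - x^- x^+ and x^+ x^-: a rational function invariant under w/z -> z/w;
    - Phi(z) x^+(w) and Psi*(z) x^-(w): 1 - w / (hbar^(1/2) z);
    - x^+(z) Phi(w) and x^-(z) Psi*(w): 1 - hbar^(1/2) w / z, which the zero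
      modes turn into 1 - z / (hbar^(1/2) w);
    - Phi Psi* and Psi* Phi: 1 / (hbar^(1/2) w / z; t1, t2).
    The identity theorem for entire functions shows that these are the only
    meromorphic functions with the required expansion.  By Wick's theorem the
    two products of integrands then differ by the ratio of the last
    contractions, which is chi(u/v), while the dynamical parameters hbar^(P-c)
    and hbar^P are left unchanged by Psi* and Phi respectively. *)

(** * Limits of complex sequences *)

(** A contraction is selected by choice among the meromorphic functions with the prescribed
    expansion near w/z = 0, so computing one takes both existence (an explicit function with that
    expansion) and uniqueness. Meromorphic means a quotient of entire functions without common
    zeros, with value 0 at the poles; uniqueness is therefore an equality of total functions. For
    Phi and Psi* existence also requires the double product to be entire, while its expression as
    the exponential of a mode sum converges only in the unit disc. Hence the detour through power
    series, carried out with the real-valued norm [normc].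

    In every exchanged pair exactly one current is built on alpha'. The ratio of alpha' to alpha
    cancels the p-dependent part of the Heisenberg bracket, which is why no p or p* survives in
    these contractions.

    The exchange holds between integrands at each point of the cycles. Contractions involving an
    integration variable agree in both orders even at their poles, where both take the value 0;
    regularity of chi(u/v) serves only the contraction of Phi with Psi*. *)

Section ComplexSequences.
Variable R : realType.
Local Notation C := R[i].
Local Notation normc := (@ComplexField.Normc.normc R).
Implicit Types (w : nat -> C) (z l : C).

Lemma normr_normc z : `|z| = (normc z)%:C%C.
Proof. by rewrite normc_def; case: z. Qed.

Lemma normc_ge0 z : 0 <= normc z.
Proof. by case: z => x y; exact: sqrtr_ge0. Qed.

Lemma normc_eq0 z : (normc z == 0) = (z == 0).
Proof.
apply/eqP/eqP => [|->]; first exact: ComplexField.Normc.eq0_normc.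
exact: ComplexField.Normc.normc0.
Qed.

Lemma normc_gt0 z : (0 < normc z) = (z != 0).
Proof. by rewrite lt_def normc_eq0 normc_ge0 andbT. Qed.

Lemma normcM z z' : normc (z * z') = normc z * normc z'.
Proof. exact: ComplexField.Normc.normcM. Qed.

Lemma normcD z z' : normc (z + z') <= normc z + normc z'.
Proof. exact: le_normcD. Qed.

Lemma normcN z : normc (- z) = normc z.
Proof. by case: z => x y /=; rewrite !sqrrN. Qed.

Lemma normcBl z z' : normc z - normc z' <= normc (z - z').
Proof. by rewrite lerBlDr; apply: le_trans (normcD _ _); rewrite subrK. Qed.

Lemma normcX z n : normc (z ^+ n) = normc z ^+ n.
Proof.
elim: n => [|n IH]; first by rewrite !expr0 ComplexField.Normc.normc1.
by rewrite !exprS normcM IH.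
Qed.

Lemma normc_real (x : R) : normc x%:C%C = `|x|.
Proof. by rewrite /= expr0n addr0 sqrtr_sqr. Qed.

Lemma normc_sum (I : Type) (s : seq I) (P : pred I) (F : I -> C) :
  normc (\sum_(i <- s | P i) F i) <= \sum_(i <- s | P i) normc (F i).
Proof.
elim/big_rec2: _ => [|i x y _ H]; first by rewrite ComplexField.Normc.normc0.
by apply: le_trans (normcD _ _) _; rewrite lerD2l.
Qed.

Lemma normc_prod (I : Type) (s : seq I) (P : pred I) (F : I -> C) :
  normc (\prod_(i <- s | P i) F i) = \prod_(i <- s | P i) normc (F i).
Proof.
elim/big_rec2: _ => [|i x y _ H]; first by rewrite ComplexField.Normc.normc1.
by rewrite normcM H.
Qed.

Lemma normc_lt1 z : `|z| < 1 -> normc z < 1.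
Proof. by rewrite normr_normc -(@ltcR R _ 1). Qed.

Lemma normc_geRe z : `|complex.Re z| <= normc z.
Proof. by have := normc_ge_Re z; rewrite normr_normc lecR. Qed.

Lemma normc_geIm z : `|complex.Im z| <= normc z.
Proof.
case: z => x y /=; rewrite -sqrtr_sqr ler_wsqrtr // lerDr; exact: sqr_ge0.
Qed.

Lemma normc_leReIm z : normc z <= `|complex.Re z| + `|complex.Im z|.
Proof.
case: z => x y /=; rewrite -[leRHS]ger0_norm ?addr_ge0 // -sqrtr_sqr.
rewrite ler_wsqrtr // -(real_normK (num_real x)) -(real_normK (num_real y)).
have := normr_ge0 x; have := normr_ge0 y; nra.
Qed.

Lemma cReD z z' : complex.Re (z + z') = complex.Re z + complex.Re z'.
Proof. by case: z; case: z'. Qed.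
Lemma cImD z z' : complex.Im (z + z') = complex.Im z + complex.Im z'.
Proof. by case: z; case: z'. Qed.
Lemma cReN z : complex.Re (- z) = - complex.Re z.
Proof. by case: z. Qed.
Lemma cImN z : complex.Im (- z) = - complex.Im z.
Proof. by case: z. Qed.
Lemma cReM z z' : complex.Re (z * z') =
  complex.Re z * complex.Re z' - complex.Im z * complex.Im z'.
Proof. by case: z; case: z'. Qed.
Lemma cImM z z' : complex.Im (z * z') =
  complex.Re z * complex.Im z' + complex.Im z * complex.Re z'.
Proof. by case: z => a b; case: z' => c d. Qed.

Definition ccv w l :=
  ((fun n => complex.Re (w n)) @ \oo --> complex.Re l) /\
  ((fun n => complex.Im (w n)) @ \oo --> complex.Im l).

Lemma ccv_lim w l : ccv w l -> clim w = l.
Proof.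
case=> r i; rewrite /clim (cvg_lim _ r) // (cvg_lim _ i) //; by case: l {r i}.
Qed.

Lemma ccv_ccvg w l : ccv w l -> ccvg w.
Proof.
by case=> r i; split; apply/cvg_ex; [exists (complex.Re l)|exists (complex.Im l)].
Qed.

Lemma ccvgP w : ccvg w -> ccv w (clim w).
Proof. by case. Qed.

Lemma ccv_unique w l l' : ccv w l -> ccv w l' -> l = l'.
Proof. by move=> /ccv_lim <- /ccv_lim <-. Qed.

Lemma ccv_cst z : ccv (fun=> z) z.
Proof. by split; exact: cvg_cst. Qed.

Lemma ccv_eventually w w' l N : (forall n, (N <= n)%N -> w n = w' n) ->
  ccv w l -> ccv w' l.
Proof.
move=> ww' [r i]; split.
  apply: cvg_trans r; apply: near_eq_cvg; near=> n; rewrite ww' //.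
  by near: n; exists N.
apply: cvg_trans i; apply: near_eq_cvg; near=> n; rewrite ww' //.
by near: n; exists N.
Unshelve. all: by end_near. Qed.

Lemma ccvD w w' l l' : ccv w l -> ccv w' l' -> ccv (fun n => w n + w' n) (l + l').
Proof.
move=> [r i] [r' i']; split.
  rewrite cReD (_ : (fun n => _) = (fun n => complex.Re (w n) + complex.Re (w' n))).
    exact: cvgD.
  by apply/funext => n; rewrite cReD.
rewrite cImD (_ : (fun n => _) = (fun n => complex.Im (w n) + complex.Im (w' n))).
  exact: cvgD.
by apply/funext => n; rewrite cImD.
Qed.

Lemma ccvM w w' l l' : ccv w l -> ccv w' l' -> ccv (fun n => w n * w' n) (l * l').
Proof.
move=> [r i] [r' i']; split.
  rewrite cReM (_ : (fun n => _) = (fun n => complex.Re (w n) * complex.Re (w' n)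
     - complex.Im (w n) * complex.Im (w' n))).
    by apply: cvgB; exact: cvgM.
  by apply/funext => n; rewrite cReM.
rewrite cImM (_ : (fun n => _) = (fun n => complex.Re (w n) * complex.Im (w' n)
     + complex.Im (w n) * complex.Re (w' n))).
  by apply: cvgD; exact: cvgM.
by apply/funext => n; rewrite cImM.
Qed.

Lemma ccvZ k w l : ccv w l -> ccv (fun n => k * w n) (k * l).
Proof. by apply: ccvM; exact: ccv_cst. Qed.

Lemma ccvB w w' l l' : ccv w l -> ccv w' l' -> ccv (fun n => w n - w' n) (l - l').
Proof.
move=> cw cw'; rewrite -mulN1r (_ : (fun n => _) = (fun n => w n + (-1) * w' n)).
  by apply: ccvD => //; exact: ccvZ.
by apply/funext => n; rewrite mulN1r.
Qed.

Lemma ccv_squeeze w l (b : nat -> R) :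
  (forall n, normc (w n - l) <= b n) -> b @ \oo --> 0 -> ccv w l.
Proof.
move=> wb b0; split; apply/subr_cvg0; apply/norm_cvg0P.
  apply: squeeze_cvgr (@cvg_cst _ _ _ _ _) b0; apply: nearW => n.
  rewrite normr_ge0 /=; apply: le_trans (wb n).
  by apply: le_trans (normc_geRe _); rewrite cReD cReN.
apply: squeeze_cvgr (@cvg_cst _ _ _ _ _) b0; apply: nearW => n.
rewrite normr_ge0 /=; apply: le_trans (wb n).
by apply: le_trans (normc_geIm _); rewrite cImD cImN.
Qed.

Lemma ccv_normc w l : ccv w l -> (fun n => normc (w n - l)) @ \oo --> 0.
Proof.
move=> [r i].
apply: (squeeze_cvgr (f := fun=> 0) (h := fun n =>
   `|complex.Re (w n) - complex.Re l| + `|complex.Im (w n) - complex.Im l|)).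
- apply: nearW => n; rewrite normc_ge0 /=; apply: le_trans (normc_leReIm _) _.
  by rewrite cReD cReN cImD cImN.
- exact: cvg_cst.
- rewrite -(addr0 0); apply: cvgD; apply/norm_cvg0P; exact/subr_cvg0.
Qed.

Lemma ccv_norm_le w l b N : ccv w l ->
  (forall n, (N <= n)%N -> normc (w n) <= b) -> normc l <= b.
Proof.
move=> /ccv_normc wl wb; rewrite -subr_le0 -(cvg_lim _ wl) //.
apply: limr_ge; first by apply/cvg_ex; exists 0.
near=> n; have := normcBl l (w n).
have : normc (w n) <= b by apply: wb; near: n; exists N.
by rewrite -(normcN (l - w n)) opprB; lra.
Unshelve. all: by end_near. Qed.

Lemma ccv_norm_ge w l b N : ccv w l ->
  (forall n, (N <= n)%N -> b <= normc (w n)) -> b <= normc l.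
Proof.
move=> /ccv_normc wl wb; rewrite -subr_le0 -(cvg_lim _ wl) //.
apply: limr_ge; first by apply/cvg_ex; exists 0.
near=> n; have := normcBl (w n) l.
have : b <= normc (w n) by apply: wb; near: n; exists N.
by lra.
Unshelve. all: by end_near. Qed.

(** For each real coordinate x of [w], both m and m + x are nondecreasing and bounded above, so x =
    (m + x) - m converges. Stating the bound with increments of [m] covers series as well as
    sequences of products. *)
Lemma ccvg_dominated w (m : nat -> R) (b : R) :
  (forall n, normc (w n.+1 - w n) <= m n.+1 - m n) -> (forall n, m n <= b) ->
  ccvg w.
Proof.
move=> wm mb.
have real_dom (x : nat -> R) : (forall n, `|x n.+1 - x n| <= m n.+1 - m n) ->
    cvgn x.
  move=> xm.
  have dec : forall n, x n.+1 - x n <= m n.+1 - m n /\ x n - x n.+1 <= m n.+1 - m n.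
    by move=> n; move: (xm n); rewrite ler_norml => /andP[]; lra.
  have mcv : cvgn m.
    apply: nondecreasing_is_cvgn; last by exists b => _ [n _ <-].
    by apply/nondecreasing_seqP => n; have := dec n; lra.
  have bnd n : x n <= m n + (x 0 - m 0).
    by elim: n => [|n IH]; [|have := dec n]; lra.
  have : cvgn (fun n => m n + x n).
    apply: nondecreasing_is_cvgn.
      by apply/nondecreasing_seqP => n; have := dec n; lra.
    exists (b + b + (x 0 - m 0)) => _ [n _ <-].
    by have := bnd n; have := mb n; lra.
  move=> mxcv; have : cvgn (fun n => m n + x n - m n) by exact: is_cvgB.
  by rewrite (_ : (fun n => _) = x) //; apply/funext => n; lra.
split; apply: real_dom => n; apply: le_trans (wm n).
  by apply: le_trans (normc_geRe _); rewrite cReD cReN.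
by apply: le_trans (normc_geIm _); rewrite cImD cImN.
Qed.

Lemma ccvg_series_dominated (f : nat -> C) (g : nat -> R) (b : R) :
  (forall n, normc (f n) <= g n) -> (forall n, \sum_(k < n) g k <= b) ->
  ccvg (fun n => \sum_(k < n) f k).
Proof.
move=> fg gb; apply: (@ccvg_dominated _ (fun n => \sum_(k < n) g k) b) => // n.
by rewrite !big_ord_recr /= addrAC subrr add0r addrAC subrr add0r.
Qed.

Lemma ccv_sum (I : Type) (s : seq I) (F : I -> nat -> C) (l : I -> C) :
  (forall i, ccv (F i) (l i)) ->
  ccv (fun n => \sum_(i <- s) F i n) (\sum_(i <- s) l i).
Proof.
move=> Fl; elim: s => [|i s IH].
  rewrite big_nil (_ : (fun n => _) = (fun=> 0)); first exact: ccv_cst.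
  by apply/funext => n; rewrite big_nil.
rewrite big_cons (_ : (fun n => _) = (fun n => F i n + \sum_(j <- s) F j n)).
  exact: ccvD.
by apply/funext => n; rewrite big_cons.
Qed.

Lemma cexp0 : cexp (0 : C) = 1.
Proof. by rewrite /cexp /= expR0 cos0 sin0 mulr0 mulr1. Qed.

Lemma cexpD z z' : cexp (z + z') = cexp z * cexp z'.
Proof.
case: z z' => a b [c d]; rewrite /cexp /= expRD cosD sinD.
by congr Complex; ring.
Qed.

Lemma cexp_neq0 z : cexp z != 0.
Proof.
apply/eqP => e0; have := cexpD z (- z); rewrite subrr cexp0 e0 mul0r.
by move/eqP; rewrite oner_eq0.
Qed.

Lemma cexpN z : cexp (- z) = (cexp z)^-1.
Proof.
by apply: (mulIf (cexp_neq0 z)); rewrite -cexpD addrC subrr cexp0 mulVf ?cexp_neq0.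
Qed.

Lemma cexp_sum (I : Type) (s : seq I) (F : I -> C) :
  cexp (\sum_(i <- s) F i) = \prod_(i <- s) cexp (F i).
Proof. by elim: s => [|i s IH]; rewrite ?big_nil ?cexp0 // !big_cons cexpD IH. Qed.

Lemma normc_cexp z : normc (cexp z) = expR (complex.Re z).
Proof.
by rewrite /cexp /= !exprMn -mulrDr cos2Dsin2 mulr1 sqrtr_sqr ger0_norm ?expR_ge0.
Qed.

Lemma ccv_cexp w l : ccv w l -> ccv (fun n => cexp (w n)) (cexp l).
Proof.
move=> [r i]; split; rewrite /cexp /=; apply: cvgM.
- exact: (continuous_cvg (h := expR) _ (@continuous_expR R _) r).
- exact: (continuous_cvg (h := cos) _ (@continuous_cos R _) i).
- exact: (continuous_cvg (h := expR) _ (@continuous_expR R _) r).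
- exact: (continuous_cvg (h := sin) _ (@continuous_sin R _) i).
Qed.
End ComplexSequences.

(** * Sums over modes and the logarithm *)

Section ModeSums.
Variable R : realType.
Local Notation C := R[i].
Local Notation normc := (@ComplexField.Normc.normc R).
Implicit Types (f g : nat -> C) (z l : C).

Definition modes f M := \sum_(1 <= m < M) f m.

Lemma modesE f n : modes f n.+1 = \sum_(k < n) f k.+1.
Proof. by rewrite /modes big_add1 big_mkord. Qed.

Lemma ccv_modes f l : ccv (fun n => \sum_(k < n) f k.+1) l -> ccv (modes f) l.
Proof.
move=> [r i]; split; rewrite -cvg_shiftS.
  rewrite (_ : [sequence _]_n = fun n => complex.Re (\sum_(k < n) f k.+1)) //.
  by apply/funext => n; rewrite /= modesE.
rewrite (_ : [sequence _]_n = fun n => complex.Im (\sum_(k < n) f k.+1)) //.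
by apply/funext => n; rewrite /= modesE.
Qed.

Lemma geometric_sum_le (r : R) n : 0 <= r < 1 -> \sum_(k < n) r ^+ k.+1 <= r / (1 - r).
Proof.
move=> /andP[r0 r1]; have r1' : 0 < 1 - r by rewrite subr_gt0.
rewrite ler_pdivlMr // (eq_bigr (fun k : 'I_n => r * r ^+ k)); last first.
  by move=> k _; rewrite exprS.
rewrite -mulr_sumr -mulrA -[leRHS]mulr1 ler_wpM2l //.
rewrite mulrC -[1 - r]opprB mulNr -subrX1 opprB gerBl; exact: exprn_ge0.
Qed.

Lemma ccvg_modes f (K r : R) : 0 <= r < 1 ->
  (forall m, (0 < m)%N -> normc (f m) <= K * r ^+ m) -> ccvg (modes f).
Proof.
move=> r01 fK; apply: (ccv_ccvg (ccv_modes (ccvgP _))).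
have K0 : 0 <= K * r by have := fK 1 isT; apply: le_trans; exact: normc_ge0.
have /andP[r0 _] := r01.
(* [|K|] replaces [K], whose sign the hypothesis leaves open when r = 0. *)
apply: (@ccvg_series_dominated _ (fun k => f k.+1) (fun k => K * r ^+ k.+1) (`|K| * (r / (1 - r)))).
  by move=> n; exact: fK.
move=> n; rewrite -mulr_sumr; apply: le_trans (_ : `|K| * \sum_(k < n) r ^+ k.+1 <= _).
  by rewrite ler_wpM2r ?ler_norm // sumr_ge0 // => k _; rewrite exprn_ge0.
by rewrite ler_wpM2l // geometric_sum_le.
Qed.

Lemma normc_modesum_le f (K r : R) : 0 <= r < 1 ->
  (forall m, (0 < m)%N -> normc (f m) <= K * r ^+ m) ->
  normc (modesum f) <= `|K| * (r / (1 - r)).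
Proof.
move=> r01 fK; have /andP[r0 _] := r01.
apply: (ccv_norm_le (N := 0) (ccvgP (ccvg_modes r01 fK))) => -[|n] _.
  rewrite /modes big_geq // ComplexField.Normc.normc0.
  by rewrite mulr_ge0 // divr_ge0 // subr_ge0 ltW //; case/andP: r01.
rewrite modesE; apply: le_trans (normc_sum _ _ _) _.
apply: le_trans (_ : `|K| * \sum_(k < n) r ^+ k.+1 <= _).
  rewrite mulr_sumr ler_sum // => k _; apply: le_trans (fK _ _) _ => //.
  by rewrite ler_wpM2r ?ler_norm ?exprn_ge0.
by rewrite ler_wpM2l // geometric_sum_le.
Qed.

Lemma eq_modesum f g : (forall m, (0 < m)%N -> f m = g m) -> modesum f = modesum g.
Proof.
move=> fg; rewrite /modesum; congr clim; apply/funext => M.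
by apply: eq_big_nat => m /andP[m0 _]; exact: fg.
Qed.

Lemma ccv_modesum f : ccvg (modes f) -> ccv (modes f) (modesum f).
Proof. exact: ccvgP. Qed.

Lemma modesumD f g : ccvg (modes f) -> ccvg (modes g) ->
  modesum (fun m => f m + g m) = modesum f + modesum g.
Proof.
move=> /ccv_modesum cf /ccv_modesum cg; apply: ccv_lim.
rewrite (_ : (fun M => _) = fun M => modes f M + modes g M); first exact: ccvD.
by apply/funext => M; rewrite /modes big_split.
Qed.

Lemma ccvg_modesD f g : ccvg (modes f) -> ccvg (modes g) ->
  ccvg (modes (fun m => f m + g m)).
Proof.
move=> /ccv_modesum cf /ccv_modesum cg; apply: (@ccv_ccvg _ _ (modesum f + modesum g)).
rewrite (_ : modes _ = fun M => modes f M + modes g M); first exact: ccvD.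
by apply/funext => M; rewrite /modes big_split.
Qed.

Lemma modesumZ k f : ccvg (modes f) -> modesum (fun m => k * f m) = k * modesum f.
Proof.
move=> /ccv_modesum cf; apply: ccv_lim.
rewrite (_ : (fun M => _) = fun M => k * modes f M); first exact: ccvZ.
by apply/funext => M; rewrite /modes mulr_sumr.
Qed.

Lemma ccv_modes_sum (I : Type) (s : seq I) (F : I -> nat -> C) (l : I -> C) :
  (forall i, ccv (modes (F i)) (l i)) ->
  ccv (modes (fun m => \sum_(i <- s) F i m)) (\sum_(i <- s) l i).
Proof.
move=> cF; rewrite (_ : modes _ = fun M => \sum_(i <- s) modes (F i) M).
  exact: ccv_sum.
by apply/funext => M; rewrite /modes exchange_big.
Qed.

Lemma ccvg_modes_finsupp f : finsupp f -> ccvg (modes f).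
Proof.
move=> [N fN]; apply: (@ccv_ccvg _ _ (modes f N.+1)).
apply: (@ccv_eventually _ (fun=> modes f N.+1) _ _ N.+1); last exact: ccv_cst.
move=> M NM; rewrite /modes [RHS](big_cat_nat _ (n := N.+1)) //=.
rewrite [X in _ = _ + X]big_nat [X in _ = _ + X]big1 ?addr0 // => m /andP[mN _].
by apply: fN; exact: ltnW.
Qed.

End ModeSums.

(** * The logarithm series, by differentiation along a real segment *)

Section Logarithm.
Variable R : realType.
Local Notation C := R[i].
Local Notation normc := (@ComplexField.Normc.normc R).

(** A real parameter suffices: the logarithm is only followed along the segment from 0 to x. *)
Definition cderiv (f : R -> C) (t : R) (d : C) :=
  is_derive t 1 (fun u => complex.Re (f u)) (complex.Re d) /\
  is_derive t 1 (fun u => complex.Im (f u)) (complex.Im d).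

Lemma cderiv_eq f t d d' : cderiv f t d -> d = d' -> cderiv f t d'.
Proof. by move=> ? <-. Qed.

Lemma cderiv_cst z t : cderiv (fun=> z) t 0.
Proof. by split; exact: is_derive_cst. Qed.

Lemma cderivD f g t df dg : cderiv f t df -> cderiv g t dg ->
  cderiv (fun u => f u + g u) t (df + dg).
Proof.
move=> [fr fi] [gr gi]; split.
  rewrite (_ : (fun u => _) = (fun u => complex.Re (f u)) + (fun u => complex.Re (g u))).
    by rewrite cReD; exact: is_deriveD.
  by apply/funext => u /=; rewrite cReD.
rewrite (_ : (fun u => _) = (fun u => complex.Im (f u)) + (fun u => complex.Im (g u))).
  by rewrite cImD; exact: is_deriveD.
by apply/funext => u /=; rewrite cImD.
Qed.

Lemma cderivM f g t df dg : cderiv f t df -> cderiv g t dg ->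
  cderiv (fun u => f u * g u) t (df * g t + f t * dg).
Proof.
move=> [fr fi] [gr gi]; split.
  rewrite (_ : (fun u => _) = (fun u => complex.Re (f u)) * (fun u => complex.Re (g u))
     - (fun u => complex.Im (f u)) * (fun u => complex.Im (g u))).
    apply: (is_derive_eq (is_deriveB (is_deriveM fr gr) (is_deriveM fi gi)));
    rewrite cReD !cReM /GRing.scale /=; ring.
  by apply/funext => u /=; rewrite cReM.
rewrite (_ : (fun u => _) = (fun u => complex.Re (f u)) * (fun u => complex.Im (g u))
   + (fun u => complex.Im (f u)) * (fun u => complex.Re (g u))).
  apply: (is_derive_eq (is_deriveD (is_deriveM fr gi) (is_deriveM fi gr)));
  rewrite cImD !cImM /GRing.scale /=; ring.
by apply/funext => u /=; rewrite cImM.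
Qed.

Lemma cderiv_ofreal t : cderiv (fun u => u%:C%C) t 1.
Proof. by split; [exact: is_derive_id|exact: is_derive_cst]. Qed.

Lemma cderiv_sum n (f : nat -> R -> C) (d : nat -> C) t :
  (forall k, cderiv (f k) t (d k)) ->
  cderiv (fun u => \sum_(k < n) f k u) t (\sum_(k < n) d k).
Proof.
move=> fd; elim: n => [|n IH].
  rewrite big_ord0 (_ : (fun u => _) = fun=> 0); first exact: cderiv_cst.
  by apply/funext => u; rewrite big_ord0.
rewrite big_ord_recr (_ : (fun u => _) = fun u => \sum_(k < n) f k u + f n u).
  exact: cderivD.
by apply/funext => u; rewrite big_ord_recr.
Qed.

Lemma cderivX f t d n : cderiv f t d ->
  cderiv (fun u => f u ^+ n) t (n%:R * f t ^+ n.-1 * d).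
Proof.
move=> fd; elim: n => [|n IH].
  by rewrite mul0r mul0r; exact: cderiv_cst.
rewrite (_ : (fun u => _) = fun u => f u * f u ^+ n); last first.
  by apply/funext => u; rewrite exprS.
apply: cderiv_eq (cderivM fd IH) _ => /=.
by case: n {IH} => [|n] /=; rewrite ?expr0 ?exprS -[in RHS]natr1; ring.
Qed.

Lemma cderiv_cexp f t d : cderiv f t d ->
  cderiv (fun u => cexp (f u)) t (d * cexp (f t)).
Proof.
move=> [fr fi].
have er : is_derive t 1 (expR \o (fun u => complex.Re (f u)))
    (expR (complex.Re (f t)) * complex.Re d).
  by apply: is_derive1_comp.
have ci : is_derive t 1 (cos \o (fun u => complex.Im (f u)))
    (- sin (complex.Im (f t)) * complex.Im d).
  by apply: is_derive1_comp.
have si : is_derive t 1 (sin \o (fun u => complex.Im (f u)))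
    (cos (complex.Im (f t)) * complex.Im d).
  by apply: is_derive1_comp.
split.
  rewrite (_ : (fun u => _) = (expR \o (fun u => complex.Re (f u))) *
     (cos \o (fun u => complex.Im (f u)))) //.
  apply: (is_derive_eq (is_deriveM er ci)); rewrite cReM /= /GRing.scale /=; ring.
rewrite (_ : (fun u => _) = (expR \o (fun u => complex.Re (f u))) *
   (sin \o (fun u => complex.Im (f u)))) //.
apply: (is_derive_eq (is_deriveM er si)); rewrite cImM /= /GRing.scale /=; ring.
Qed.

(** The mean value theorem fails for complex values; it is applied to the real and imaginary parts
    separately, each contributing one [B]. *)
Lemma mean_value_bound (f : R -> C) (d : R -> C) (B : R) :
  (forall t, cderiv f t (d t)) ->
  (forall t, 0 <= t <= 1 -> normc (d t) <= B) -> normc (f 1 - f 0) <= B + B.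
Proof.
move=> fd dB.
have mvt (h dh : R -> R) : (forall t : R, is_derive t 1 h (dh t)) ->
    (forall t, 0 <= t <= 1 -> `|dh t| <= B) -> `|h 1 - h 0| <= B.
  move=> hd hB.
  have hc : {within `[0, 1], continuous h}.
    apply: continuous_subspaceT => t; apply: differentiable_continuous.
    by apply/derivable1_diffP; case: (hd t).
  have [c] := @MVT_segment R h dh 0 1 ler01 (fun t _ => hd t) hc.
  by rewrite in_itv /= subr0 mulr1 => c01 ->; exact: hB.
apply: le_trans (normc_leReIm _) _; apply: lerD; rewrite ?cReD ?cReN ?cImD ?cImN.
  apply: (mvt (fun t => complex.Re (f t)) (fun t => complex.Re (d t))).
    by move=> t; case: (fd t).
  by move=> t t01; apply: le_trans (normc_geRe _) (dB _ t01).
apply: (mvt (fun t => complex.Im (f t)) (fun t => complex.Im (d t))).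
  by move=> t; case: (fd t).
by move=> t t01; apply: le_trans (normc_geIm _) (dB _ t01).
Qed.

Lemma natC_neq0 n : n.+1%:R != 0 :> C.
Proof. by rewrite pnatr_eq0. Qed.

Lemma normc_nat n : normc n%:R = n%:R.
Proof. by rewrite -(rmorph_nat (real_complex R)) normc_real ger0_norm. Qed.

Lemma normc_expn_div (x : C) m : (0 < m)%N -> normc (x ^+ m / m%:R) <= normc x ^+ m.
Proof.
move=> m0; rewrite normcM normcX ComplexField.Normc.normcV normc_nat.
rewrite ler_piMr ?exprn_ge0 ?normc_ge0 // invf_le1 ?ltr0n //.
by rewrite ler1n.
Qed.

(* [(1 - t x) exp (sum_(m <= M) (t x)^m / m)] has derivative
   [- x (t x)^M exp (sum_(m <= M) (t x)^m / m)] in t, which tends to 0 on [0, 1]. *)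
Lemma cexp_log1 (x : C) : normc x < 1 ->
  cexp (modesum (fun m => x ^+ m / m%:R)) * (1 - x) = 1.
Proof.
move=> x1; have r01 : 0 <= normc x < 1 by rewrite normc_ge0.
set r := normc x in r01; set f := fun m => x ^+ m / m%:R.
have fr m : (0 < m)%N -> normc (f m) <= 1 * r ^+ m.
  by move=> m0; rewrite mul1r; exact: normc_expn_div.
have /ccv_modesum cf := ccvg_modes r01 fr.
pose S M t : C := \sum_(k < M) (t%:C%C * x) ^+ k.+1 / k.+1%:R.
pose D M t : C := (1 + (- x) * t%:C%C) * cexp (S M t).
have dS M t : cderiv (S M) t (\sum_(k < M) x * (t%:C%C * x) ^+ k).
  apply: (@cderiv_sum M (fun k u => (u%:C%C * x) ^+ k.+1 / k.+1%:R)
    (fun k => x * (t%:C%C * x) ^+ k)) => k.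
  have dx := cderivM (cderiv_ofreal t) (cderiv_cst x t).
  apply: (cderiv_eq (cderivM (cderivX k.+1 dx) (cderiv_cst (k.+1%:R^-1) t))).
  have alg (a b c m : C) : m != 0 -> m * a * (1 * x + b * 0) / m + c * 0 = x * a.
    by move=> m0; field.
  exact: alg (natC_neq0 k).
have dD M t : cderiv (D M) t (- x * (t%:C%C * x) ^+ M * cexp (S M t)).
  have dl := cderivD (cderiv_cst 1 t) (cderivM (cderiv_cst (- x) t) (cderiv_ofreal t)).
  apply: cderiv_eq (cderivM dl (cderiv_cexp (dS M t))) _.
  rewrite mul0r !add0r mulr1 -mulr_sumr mulrA -mulrDl; congr (_ * _).
  have := subrX1 (t%:C%C * x) M.
  move: (\sum_(i < M) _) => s e.
  rewrite (_ : (1 + - x * t%:C%C) * (x * s) = - x * ((t%:C%C * x - 1) * s)); last by ring.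
  by rewrite -e; ring.
have bD M t : 0 <= t <= 1 ->
    normc (- x * (t%:C%C * x) ^+ M * cexp (S M t)) <= r ^+ M * expR (r / (1 - r)).
  move=> /andP[t0 t1]; have /andP[r0 r1] := r01.
  have tr : normc (t%:C%C * x) <= r.
    by rewrite normcM normc_real ger0_norm // ler_piMl.
  rewrite 2!normcM normcN normcX normc_cexp; apply: ler_pM.
  - by rewrite mulr_ge0 // exprn_ge0 ?normc_ge0.
  - exact: expR_ge0.
  - apply: le_trans (ler_piMl _ (ltW r1)) _; first by rewrite exprn_ge0 ?normc_ge0.
    by rewrite lerXn2r ?nnegrE ?normc_ge0.
  rewrite ler_expR; apply: le_trans (ler_norm _) _; apply: le_trans (normc_geRe _) _.
  apply: le_trans (normc_sum _ _ _) _; apply: le_trans (geometric_sum_le M r01).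
  apply: ler_sum => k _; apply: le_trans (normc_expn_div _ (ltn0Sn _)) _.
  by rewrite lerXn2r ?nnegrE ?normc_ge0.
have D0 M : D M 0 = 1.
  rewrite /D mulr0 addr0 mul1r /S big1 ?cexp0 // => k _.
  by rewrite mul0r exprS mul0r mul0r.
have : ccv (fun M => D M 1) 1.
  apply: (@ccv_squeeze _ _ _ (fun M => r ^+ M * expR (r / (1 - r)) + r ^+ M * expR (r / (1 - r)))).
    by move=> M; rewrite -[X in _ - X](D0 M); exact: mean_value_bound (dD M) (bD M).
  have r0 : (fun M => r ^+ M) @ \oo --> (0 : R).
    by apply: cvg_expr; rewrite ger0_norm; case/andP: r01.
  rewrite -[X in _ --> X](addr0 0) -[X in _ --> X + X](mul0r (expR (r / (1 - r)))).
  by apply: cvgD; apply: cvgMr_tmp; exact: r0.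
move=> c1; apply: ccv_unique c1.
rewrite (_ : (fun M => _) = fun M => cexp (modes f M.+1) * (1 - x)); last first.
  by apply/funext => M; rewrite /D /S modesE mulrC rmorph1 mulr1; under eq_bigr do rewrite mul1r.
apply: ccvM (ccv_cst _); apply: ccv_cexp.
by case: cf => cr ci; split; [rewrite -cvg_shiftS in cr|rewrite -cvg_shiftS in ci].
Qed.

Lemma cexp_log (x : C) : normc x < 1 ->
  cexp (- modesum (fun m => x ^+ m / m%:R)) = 1 - x.
Proof.
move=> x1; rewrite cexpN; apply: (mulfI (cexp_neq0 (modesum (fun m => x ^+ m / m%:R)))).
by rewrite mulfV ?cexp_neq0 // cexp_log1.
Qed.

End Logarithm.

(** * Double products inside the unit disc *)

Lemma geometric_sumE (F : fieldType) (t : F) n :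
  t != 1 -> \sum_(i < n) t ^+ i = (1 - t ^+ n) / (1 - t).
Proof.
move=> t1; have t1' : 1 - t != 0 by rewrite subr_eq0 eq_sym.
by apply: (mulIf t1'); rewrite divfK // -[1 - t ^+ n]opprB subrX1 -mulNr opprB mulrC.
Qed.

Section DoubleProduct.
Variable R : realType.
Local Notation C := R[i].
Local Notation normc := (@ComplexField.Normc.normc R).
Implicit Types (w t a b : C).

Lemma normc_1BX t m : normc t < 1 -> (0 < m)%N -> 1 - normc t <= normc (1 - t ^+ m).
Proof.
move=> t1 m0; apply: le_trans (normcBl _ _).
rewrite ComplexField.Normc.normc1 normcX lerD2l lerN2.
by apply: ler_iXnr => //; [exact: normc_ge0|exact: ltW].
Qed.

Lemma one_subX_neq0 t m : normc t < 1 -> (0 < m)%N -> 1 - t ^+ m != 0.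
Proof.
move=> t1 m0; rewrite -normc_gt0; apply: lt_le_trans (normc_1BX t1 m0).
by rewrite subr_gt0.
Qed.

(** The denominators stay away from 0 uniformly in m, because |1 - a^m| >= 1 - |a|; so the decay is
    that of w^m. *)
Lemma normc_modes_weight w a b m : normc a < 1 -> normc b < 1 -> (0 < m)%N ->
  normc (w ^+ m / (m%:R * ((1 - a ^+ m) * (1 - b ^+ m))))
  <= ((1 - normc a) * (1 - normc b))^-1 * normc w ^+ m.
Proof.
move=> a1 b1 m0; rewrite invfM mulrA normcM mulrC.
apply: ler_pM; rewrite ?normc_ge0 ?normc_expn_div //.
rewrite ComplexField.Normc.normcV normcM lef_pV2 ?posrE; last 2 first.
- by rewrite mulr_gt0 ?normc_gt0 ?one_subX_neq0.
- by rewrite mulr_gt0 ?subr_gt0.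
by apply: ler_pM; rewrite ?subr_ge0 ?normc_1BX ?ltW.
Qed.

Lemma ccv_expr0 (t : R) : 0 <= t < 1 -> (fun n => t ^+ n) @ \oo --> (0 : R).
Proof. by move=> /andP[t0 t1]; apply: cvg_expr; rewrite ger0_norm. Qed.

(** Taking logarithms of the finite product and summing the geometric series in i and j gives the
    mode w^m / m times (1 - a^(mk)) (1 - b^(mk)) / ((1 - a^m) (1 - b^m)). The limit in k is
    exchanged with the sum over m through an error bound uniform in m. *)
Lemma ccv_qpoch2_cexp w a b : normc w < 1 -> normc a < 1 -> normc b < 1 ->
  ccv (fun k => \prod_(i < k) \prod_(j < k) (1 - w * a ^+ i * b ^+ j))
    (cexp (- modesum (fun m => w ^+ m / (m%:R * ((1 - a ^+ m) * (1 - b ^+ m)))))).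
Proof.
move=> w1 a1 b1.
have w01 : 0 <= normc w < 1 by rewrite normc_ge0.
set f := (X in modesum X); set K := ((1 - normc a) * (1 - normc b))^-1.
have K0 : 0 <= K by rewrite invr_ge0 mulr_ge0 // subr_ge0 ltW.
have cf : ccvg (modes f).
  by apply: (ccvg_modes w01 (K := K)) => m m0; exact: normc_modes_weight.
pose F k m : C := \sum_(i < k) \sum_(j < k) (w * a ^+ i * b ^+ j) ^+ m / m%:R.
have wij i j : normc (w * a ^+ i * b ^+ j) < 1.
  rewrite !normcM !normcX -mulrA; apply: le_lt_trans w1; rewrite ler_piMr ?normc_ge0 //.
  by rewrite mulr_ile1 ?exprn_ge0 ?normc_ge0 ?exprn_ile1 ?normc_ge0 ?ltW.
have cF k : ccv (modes (F k)) (\sum_(i < k) \sum_(j < k)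
    modesum (fun m => (w * a ^+ i * b ^+ j) ^+ m / m%:R)).
  apply: ccv_modes_sum => i; apply: ccv_modes_sum => j; apply: ccv_modesum.
  have wij01 : 0 <= normc (w * a ^+ i * b ^+ j) < 1 by rewrite normc_ge0 wij.
  apply: (ccvg_modes wij01 (K := 1)) => m m0; rewrite mul1r; exact: normc_expn_div.
have PF k : \prod_(i < k) \prod_(j < k) (1 - w * a ^+ i * b ^+ j) = cexp (- modesum (F k)).
  have -> : modesum (F k) = _ := ccv_lim (cF k); rewrite -sumrN cexp_sum; apply: eq_bigr => i _.
  by rewrite -sumrN cexp_sum; apply: eq_bigr => j _; rewrite cexp_log.
under eq_fun do rewrite PF; apply: ccv_cexp.
have FE k m : (0 < m)%N -> F k m = f m * ((1 - (a ^+ m) ^+ k) * (1 - (b ^+ m) ^+ k)).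
  move=> m0; have am := one_subX_neq0 a1 m0; have bm := one_subX_neq0 b1 m0.
  rewrite /F (eq_bigr (fun i : 'I_k => w ^+ m / m%:R * (a ^+ m) ^+ i *
      \sum_(j < k) (b ^+ m) ^+ j)); last first.
    move=> i _; rewrite mulr_sumr; apply: eq_bigr => j _.
    by rewrite !exprMn -!exprM ![(m * _)%N]mulnC; ring.
  have am' : a ^+ m != 1 by rewrite eq_sym -subr_eq0.
  have bm' : b ^+ m != 1 by rewrite eq_sym -subr_eq0.
  rewrite -mulr_suml -mulr_sumr (geometric_sumE k am') (geometric_sumE k bm').
  have alg (W M A B p q : C) : W / M * (A / p) * (B / q) = W / (M * (p * q)) * (A * B).
    by rewrite !invfM; ring.
  exact: alg.
(* Bounds (1 - x) (1 - y) - 1 = - x - y + x y at x = a^(mk), y = b^(mk), where m >= 1 gives |x| <=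
   |a|^k and |y| <= |b|^k. *)
pose e k := normc a ^+ k + normc b ^+ k + normc a ^+ k * normc b ^+ k.
have e0 : (fun k => K * e k * (normc w / (1 - normc w))) @ \oo --> (0 : R).
  have a0 := @ccv_expr0 (normc a); have b0 := @ccv_expr0 (normc b).
  rewrite !normc_ge0 a1 in a0; rewrite !normc_ge0 b1 in b0.
  rewrite -[X in _ --> X](mul0r (normc w / (1 - normc w))); apply: cvgMr_tmp.
  rewrite -[X in _ --> X](mulr0 K); apply: cvgMl_tmp.
  rewrite -[X in _ --> X](addr0 0); apply: cvgD.
    by rewrite -[X in _ --> X](addr0 0); apply: cvgD; [exact: a0|exact: b0].
  by rewrite -[X in _ --> X](mulr0 0); apply: cvgM; [exact: a0|exact: b0].
have cN : ccv (fun k => modesum (F k)) (modesum f).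
  apply: ccv_squeeze e0 => k.
  have ek0 : 0 <= K * e k.
    by rewrite mulr_ge0 // !addr_ge0 ?mulr_ge0 ?exprn_ge0 ?normc_ge0.
  rewrite -mulN1r -modesumZ // -modesumD; last 2 first.
  - exact: ccv_ccvg (cF k).
  - rewrite (_ : modes _ = fun M => - 1 * modes f M).
      exact: ccv_ccvg (ccvZ _ (ccv_modesum cf)).
    by apply/funext => M; rewrite /modes mulr_sumr.
  rewrite -[K * e k]ger0_norm //; apply: normc_modesum_le => // m m0.
  rewrite FE // (_ : _ + _ = f m * (- (a ^+ m) ^+ k - (b ^+ m) ^+ k
    + (a ^+ m) ^+ k * (b ^+ m) ^+ k)); last by ring.
  rewrite normcM mulrAC; apply: ler_pM; rewrite ?normc_ge0 //.
    rewrite /f /K; exact: normc_modes_weight.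
  have le c : normc c < 1 -> normc ((c ^+ m) ^+ k) <= normc c ^+ k.
    move=> c1; rewrite !normcX -exprM mulnC exprM.
    by apply: ler_iXnr => //; rewrite ?exprn_ge0 ?exprn_ile1 ?normc_ge0 ?ltW.
  apply: le_trans (normcD _ _) _; apply: lerD; last first.
    by rewrite normcM; apply: ler_pM; rewrite ?normc_ge0 ?le.
  by apply: le_trans (normcD _ _) _; apply: lerD; rewrite normcN le.
have := ccvZ (-1) cN; rewrite mulN1r.
by under eq_fun do rewrite mulN1r.
Qed.

(** Weierstrass' product inequality. In the induction a factor with |x i| >= 1 makes the left side
    nonpositive, and the signs of the sum and the product are carried along for that case. *)
Lemma prod_normc_ge (I : Type) (s : seq I) (P : pred I) (x : I -> C) :
  1 - \sum_(i <- s | P i) normc (x i) <= \prod_(i <- s | P i) normc (1 - x i).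
Proof.
suff : [/\ 1 - \sum_(i <- s | P i) normc (x i) <= \prod_(i <- s | P i) normc (1 - x i),
    0 <= \sum_(i <- s | P i) normc (x i) & 0 <= \prod_(i <- s | P i) normc (1 - x i)].
  by case.
elim/big_rec2: _ => [|i p S _ [pS S0 p0]]; first by rewrite subr0.
split; [|by rewrite addr_ge0 ?normc_ge0|by rewrite mulr_ge0 ?normc_ge0].
have x1 : 1 - normc (x i) <= normc (1 - x i).
  by apply: le_trans (normcBl _ _); rewrite ComplexField.Normc.normc1.
have := normc_ge0 (x i); have := normc_ge0 (1 - x i).
have [h|h] := leP 1 (normc (x i)); nra.
Qed.
End DoubleProduct.

(** * Entire and meromorphic functions *)

Section Entire.
Variable R : realType.
Local Notation C := R[i].
Local Notation normc := (@ComplexField.Normc.normc R).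
Implicit Types (c d : nat -> C) (z : C) (p : {poly C}).

Definition psum c z M := \sum_(k < M) c k * z ^+ k.

(** Infinite radius of convergence, phrased as boundedness at every radius: the bound at radius 2|z|
    already yields terms decaying like 2^-k at z. *)
Definition rapid c :=
  forall rho : R, 0 <= rho -> exists K : R, forall k, normc (c k) * rho ^+ k <= K.

Lemma ccvg_bounded (w : nat -> C) : ccvg w -> exists K, forall n, normc (w n) <= K.
Proof.
case=> /cvg_has_ub[K1 ub1] /cvg_has_ub[K2 ub2]; exists (K1 + K2) => n.
apply: le_trans (normc_leReIm _) _; apply: lerD; [apply: ub1|apply: ub2] => /=.
  by exists n.
by exists n.
Qed.

(** Each term is a difference of two consecutive partial sums at the real point [rho], and
    convergent partial sums are bounded. *)
Lemma rapid_ccvg_psum c : (forall z, ccvg (psum c z)) -> rapid c.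
Proof.
move=> cc rho rho0; have [K psK] := ccvg_bounded (cc rho%:C%C).
exists (K + K) => k; rewrite -[rho]ger0_norm // -normc_real -normcX -normcM.
have -> : c k * rho%:C%C ^+ k = psum c rho%:C%C k.+1 + - psum c rho%:C%C k.
  by rewrite /psum big_ord_recr /= addrAC subrr add0r.
by apply: le_trans (normcD _ _) _; rewrite normcN lerD.
Qed.

Lemma half_exp_sum (m n : nat) : \sum_(k < n) (2^-1 : R) ^+ (m + k) <= 2 * 2^-1 ^+ m.
Proof.
rewrite (_ : \sum_(k < n) _ = 2 * 2^-1 ^+ m * (1 - 2^-1 ^+ n)); last first.
  elim: n => [|n IH]; first by rewrite big_ord0 expr0 subrr mulr0.
  rewrite big_ord_recr /= IH exprD exprS; by field.
have h0 k : 0 <= (2^-1 : R) ^+ k by rewrite exprn_ge0 // invr_ge0 ler0n.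
by rewrite ler_piMr ?mulr_ge0 ?gerBl.
Qed.

Lemma half_exp_bound (g : nat -> R) (K : R) (m n : nat) :
  (forall k, g k <= K * 2^-1 ^+ k) -> 0 <= K ->
  \sum_(k < n) g (m + k)%N <= K * (2 * 2^-1 ^+ m).
Proof.
move=> gK K0; apply: le_trans (_ : K * \sum_(k < n) 2^-1 ^+ (m + k) <= _).
  by rewrite mulr_sumr ler_sum.
by rewrite ler_wpM2l // half_exp_sum.
Qed.

Lemma coef_half_bound (a : C) (K : R) z k : normc a * (2 * normc z) ^+ k <= K ->
  normc (a * z ^+ k) <= K * 2^-1 ^+ k.
Proof.
rewrite normcM normcX exprMn => aK.
rewrite -[leLHS](@mulfK _ (2 ^+ k : R)) ?expf_neq0 ?pnatr_eq0 // exprVn.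
rewrite ler_wpM2r ?invr_ge0 ?exprn_ge0 ?ler0n //.
by apply: le_trans aK; rewrite mulrAC mulrA.
Qed.

Lemma psum_tail c (K : R) z m n : 0 <= K ->
  (forall k, normc (c k) * (2 * normc z) ^+ k <= K) -> (m <= n)%N ->
  normc (psum c z n - psum c z m) <= K * (2 * 2^-1 ^+ m).
Proof.
move=> K0 cK mn; rewrite -(subnKC mn) /psum big_split_ord /= addrAC subrr add0r.
apply: le_trans (normc_sum _ _ _) _.
apply: (half_exp_bound (g := fun k => normc (c k * z ^+ k))) => // k.
exact: coef_half_bound.
Qed.

Lemma ccvg_rapid_psum c z : rapid c -> ccvg (psum c z).
Proof.
move=> rc; have [|K cK] := rc (2 * normc z); first by rewrite mulr_ge0 ?normc_ge0.
have K0 : 0 <= K by apply: le_trans (cK 0%N); rewrite mulr_ge0 ?normc_ge0.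
apply: (@ccvg_series_dominated _ (fun k => c k * z ^+ k)
  (fun k => normc (c k * z ^+ k)) (K * 2)) => // n.
have := @half_exp_bound (fun k => normc (c k * z ^+ k)) K 0 n.
rewrite expr0 mulr1; apply=> // k; exact: coef_half_bound.
Qed.

Lemma entireP f : entire f <-> exists2 c, rapid c & forall z, f z = clim (psum c z).
Proof.
split=> [[c fc]|[c rc fc]].
  exists c; last by move=> z; case: (fc z).
  by apply: rapid_ccvg_psum => z; case: (fc z).
by exists c => z; split=> //; exact: ccvg_rapid_psum.
Qed.

Lemma ccv_pow_half (K : R) : (fun m => K * 2^-1 ^+ m) @ \oo --> (0 : R).
Proof.
have h0 : (fun m => 2^-1 ^+ m) @ \oo --> (0 : R).
  by apply: ccv_expr0; apply/andP; split; lra.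
by rewrite -[X in _ --> X](mulr0 K); apply: cvgMl_tmp; exact: h0.
Qed.

Lemma psum_poly p z n : (size p <= n)%N -> psum (fun k => p`_k) z n = p.[z].
Proof. by move=> sp; rewrite (horner_coef_wide _ sp). Qed.

(** The bound uniform in N at every radius makes the tails of all [P N] geometrically small at once,
    and it passes to the limit coefficients. What remains is a finite head, where coefficientwise
    convergence is enough. *)
Lemma ccv_poly_limit (P : nat -> {poly C}) c :
  (forall rho : R, 0 <= rho -> exists K : R, forall N k, normc (P N)`_k * rho ^+ k <= K) ->
  (forall k, ccv (fun N => (P N)`_k) (c k)) ->
  rapid c /\ forall z, ccv (fun N => (P N).[z]) (clim (psum c z)).
Proof.
move=> PK Pc; have rc : rapid c.
  move=> rho rho0; have [K PK'] := PK _ rho0; exists K => k.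
  have rk : normc (rho%:C%C ^+ k) = rho ^+ k by rewrite normcX normc_real ger0_norm.
  rewrite -rk -normcM.
  apply: (ccv_norm_le (N := 0) (w := fun N => (P N)`_k * rho%:C%C ^+ k)).
    by apply: ccvM (Pc k) _; exact: ccv_cst.
  by move=> N _; rewrite normcM rk.
split=> // z; have [|K PK'] := PK (2 * normc z); first by rewrite mulr_ge0 ?normc_ge0.
have [|K' cK'] := rc (2 * normc z); first by rewrite mulr_ge0 ?normc_ge0.
have K0 : 0 <= K by apply: le_trans (PK' 0%N 0%N); rewrite mulr_ge0 ?normc_ge0.
have K'0 : 0 <= K' by apply: le_trans (cK' 0%N); rewrite mulr_ge0 ?normc_ge0.
have cz := ccvgP (ccvg_rapid_psum z rc).
set L := clim _ in cz *.
have tailL m : normc (L - psum c z m) <= K' * (2 * 2^-1 ^+ m).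
  have := ccvB cz (ccv_cst (psum c z m)).
  by move=> /ccv_norm_le; apply=> n; exact: psum_tail.
have tailP N m : normc ((P N).[z] - psum (fun k => (P N)`_k) z m) <= K * (2 * 2^-1 ^+ m).
  rewrite -(@psum_poly (P N) z (maxn (size (P N)) m)) ?leq_maxl //.
  by apply: psum_tail; rewrite ?leq_maxr // => k; exact: PK'.
apply: (@ccv_squeeze _ _ _ (fun N => normc ((P N).[z] - L))) => //.
apply/cvgrPdist_lt => e e0.
(* The cutoff m makes the tails of [P N] and of the limit together smaller than e / 2; N0 then
   brings the heads of length m within e / 2. *)
have /cvgrPdist_lt/(_ (e / 2)) := ccv_pow_half ((K + K') * 2).
case=> [|m _ /(_ m (leqnn m))]; first by rewrite divr_gt0.
rewrite /= sub0r normrN ger0_norm; last first.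
  by rewrite !mulr_ge0 ?addr_ge0 ?exprn_ge0 ?invr_ge0 ?ler0n.
move=> me.
have /ccv_normc/cvgrPdist_lt/(_ (e / 2)) : ccv (fun N => psum (fun k => (P N)`_k) z m) (psum c z m).
  by apply: ccv_sum => k; apply: ccvM (Pc k) _; exact: ccv_cst.
case=> [|N0 _ HN]; first by rewrite divr_gt0.
exists N0 => // N /= /HN /=; rewrite !sub0r !normrN !ger0_norm ?normc_ge0 // => NE.
have := tailL m; have := tailP N m.
set p := psum _ _ _ in NE *; set q := psum _ _ _ in NE *.
have -> : (P N).[z] - L = ((P N).[z] - p) + (p - q) - (L - q) by ring.
have := normcD ((P N).[z] - p + (p - q)) (- (L - q)).
have := normcD ((P N).[z] - p) (p - q).
rewrite normcN; move: me NE; set h := 2^-1 ^+ m; nra.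
Qed.

Lemma coef_le_horner (q : {poly R}) (rho : R) k : 0 <= rho ->
  (forall j, 0 <= q`_j) -> q`_k * rho ^+ k <= q.[rho].
Proof.
move=> rho0 q0; have [kq|kq] := ltnP k (size q); last first.
  rewrite nth_default // mul0r horner_coef sumr_ge0 // => j _.
  by rewrite mulr_ge0 ?exprn_ge0.
rewrite horner_coef (bigD1 (Ordinal kq)) //= lerDl sumr_ge0 // => j _.
by rewrite mulr_ge0 ?exprn_ge0.
Qed.

Lemma entire_poly p : entire (fun z => p.[z]).
Proof.
exists (fun k => p`_k) => z.
have cp : ccv (psum (fun k => p`_k) z) p.[z].
  apply: (@ccv_eventually _ (fun=> p.[z]) _ _ (size p)); last exact: ccv_cst.
  by move=> n sp; rewrite psum_poly.
by split; [exact: ccv_ccvg cp|rewrite [RHS](ccv_lim cp)].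
Qed.

Lemma entire_scale f a : entire f -> entire (fun z => f (a * z)).
Proof.
move=> [c fc]; exists (fun k => c k * a ^+ k) => z.
have [] := fc (a * z).
by under [X in ccvg X]eq_fun do under eq_bigr do rewrite exprMn mulrA;
  under [X in clim X]eq_fun do under eq_bigr do rewrite exprMn mulrA.
Qed.

Lemma entireB f g : entire f -> entire g -> entire (fun z => f z - g z).
Proof.
move=> [c fc] [d gd]; exists (fun k => c k - d k) => z.
have [/ccvgP cf ->] := fc z; have [/ccvgP cg ->] := gd z.
have := ccvB cf cg.
rewrite (_ : (fun n => _) = fun M => \sum_(k < M) (c k - d k) * z ^+ k).
  by move=> h; split; [exact: ccv_ccvg h|rewrite (ccv_lim h)].
by apply/funext => M; rewrite -sumrB; apply: eq_bigr => k _; rewrite mulrBl.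
Qed.

(** The Cauchy product is compared with the product of the truncations [A M] and [B M]: their
    coefficients agree below M, so the two differ by a tail of the polynomial [A M * B M]. *)
Lemma entireM f g : entire f -> entire g -> entire (fun z => f z * g z).
Proof.
move=> /entireP[a ra fa] /entireP[b rb gb].
pose c n := \sum_(i < n.+1) a i * b (n - i)%N.
suff cc z : ccv (psum c z) (f z * g z).
  by exists c => z; split; [exact: ccv_ccvg (cc z)|rewrite [RHS](ccv_lim (cc z))].
(* Radius 4|z|: one factor 2 absorbs the n + 1 <= 2^n summands of the n-th coefficient, the other is
   the one that [psum_tail] asks for. *)
have [|Ka aK] := ra (4 * normc z); first by rewrite mulr_ge0 ?normc_ge0.
have [|Kb bK] := rb (4 * normc z); first by rewrite mulr_ge0 ?normc_ge0.
have Ka0 : 0 <= Ka by apply: le_trans (aK 0%N); rewrite mulr_ge0 ?normc_ge0.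
have Kb0 : 0 <= Kb by apply: le_trans (bK 0%N); rewrite mulr_ge0 ?normc_ge0.
pose A M : {poly C} := \poly_(i < M) a i; pose B M : {poly C} := \poly_(i < M) b i.
have AE M : (A M).[z] = psum a z M by rewrite horner_poly.
have BE M : (B M).[z] = psum b z M by rewrite horner_poly.
have sAB M : (size (A M * B M)%R <= M + M)%N.
  apply: leq_trans (size_polyMleq _ _) _; apply: leq_trans (leq_pred _) _.
  by apply: leq_add; exact: size_poly.
have ABc M n : (n < M)%N -> (A M * B M)`_n = c n.
  move=> nM; rewrite coefM; apply: eq_bigr => i _; rewrite !coef_poly.
  by rewrite (leq_ltn_trans _ nM) ?(leq_ltn_trans _ nM) ?leq_subr // -ltnS.
have AB_le M n : normc (A M * B M)`_n * (2 * normc z) ^+ n <= Ka * Kb.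
  rewrite coefM.
  have le2 : n.+1%:R <= 2 ^+ n :> R by rewrite -natrX ler_nat ltn_expl.
  have term i : (i < n.+1)%N ->
      normc ((A M)`_i * (B M)`_(n - i)) * (4 * normc z) ^+ n <= Ka * Kb.
    move=> le_in; rewrite -{2}(subnKC (ltnSE le_in)) exprD normcM mulrACA.
    apply: ler_pM; rewrite ?mulr_ge0 ?exprn_ge0 ?mulr_ge0 ?normc_ge0 //; rewrite coef_poly.
      by case: ifP => // _; rewrite ComplexField.Normc.normc0 mul0r.
    by case: ifP => // _; rewrite ComplexField.Normc.normc0 mul0r.
  have le4 : normc (\sum_(i < n.+1) (A M)`_i * (B M)`_(n - i)) * (4 * normc z) ^+ n
      <= n.+1%:R * (Ka * Kb).
    apply: le_trans (ler_wpM2r _ (normc_sum _ _ _)) _.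
      by rewrite exprn_ge0 // mulr_ge0 ?normc_ge0.
    have -> : n.+1%:R * (Ka * Kb) = \sum_(i < n.+1) Ka * Kb.
      by rewrite sumr_const card_ord mulr_natl.
    by rewrite mulr_suml; apply: ler_sum => i _; exact: term.
  have p2 : (0 : R) < 2 ^+ n by rewrite exprn_gt0.
  rewrite -(ler_pM2l p2); apply: le_trans (_ : n.+1%:R * (Ka * Kb) <= _); last first.
    by rewrite ler_wpM2r ?mulr_ge0.
  apply: le_trans le4; rewrite mulrCA -exprMn mulrA -natrM //.
have cAB : ccv (fun M => (A M * B M).[z]) (f z * g z).
  rewrite fa gb; under eq_fun do rewrite hornerM AE BE.
  by apply: ccvM; apply: ccvgP; exact: ccvg_rapid_psum.
have dAB : ccv (fun M => psum c z M - (A M * B M).[z]) 0.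
  apply: ccv_squeeze (ccv_pow_half (Ka * Kb * 2)) => M.
  rewrite subr0 -normcN opprB -mulrA -(psum_poly z (sAB M)).
  rewrite (_ : psum c z M = psum (fun k => (A M * B M)`_k) z M); last first.
    by apply: eq_bigr => k _; rewrite ABc.
  by apply: psum_tail; rewrite ?mulr_ge0 ?leq_addr.
have := ccvD dAB cAB; rewrite add0r.
by under eq_fun do rewrite subrK.
Qed.

(** With [c k] the first nonzero coefficient, f z = z^k (c k + z s(z)), and s is bounded near 0, so
    the bracket cannot vanish there. Only zeros near the origin matter, as the expansions are taken
    there. *)
Lemma entire_isolated_zero f : entire f -> (exists z, f z != 0) ->
  exists2 e : R, 0 < e & forall z, z != 0 -> normc z < e -> f z != 0.
Proof.
move=> /entireP[c rc fc] [z1 fz1].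
have exk : exists k, c k != 0.
  apply: contrapT => nk; move/eqP: fz1; apply; rewrite fc; apply: ccv_lim.
  apply: (@ccv_eventually _ (fun=> 0) _ _ 0%N); last exact: ccv_cst.
  move=> n _; rewrite /psum big1 // => k _.
  by have [->|ck] := eqVneq (c k) 0; [rewrite mul0r|case: nk; exists k].
have [|K cK] := rc 1; first exact: ler01.
have K0 : 0 <= K by apply: le_trans (cK 0%N); rewrite mulr_ge0 ?normc_ge0.
have {}cK j : normc (c j) <= K by have := cK j; rewrite expr1n mulr1.
case: (ex_minnP exk) => k; rewrite -normc_gt0 => ck min_k.
have IH j : (j < k)%N -> c j = 0.
  by move=> jk; apply/eqP/negPn/negP => /min_k; rewrite leqNgt jk.
have K1 : 0 < 4 * K + 1 by lra.
(* For |z| <= 1/2 the series s is at most 2 K in norm; |z| (4 K + 1) <= |c k| then makes |z s| at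
   most |c k| / 2. The summand 1 keeps the denominator positive. *)
exists (Num.min 2^-1 (normc (c k) / (4 * K + 1))).
  by rewrite lt_min invr_gt0 ltr0n divr_gt0.
move=> z; rewrite -normc_gt0 => r0.
set r := normc z in r0 *; rewrite lt_min ltr_pdivlMr // => /andP[/ltW r2 /ltW rK].
have cz : ccv (psum c z) (f z) by rewrite fc; exact: ccvgP (ccvg_rapid_psum z rc).
rewrite -normc_gt0; apply: lt_le_trans (_ : normc (c k) * r ^+ k / 2 <= _).
  by rewrite divr_gt0 // mulr_gt0 // exprn_gt0.
apply: (ccv_norm_ge (N := k.+1) cz) => n kn.
have tail m : normc (\sum_(j < m) c (k.+1 + j)%N * z ^+ j) <= K * 2.
  apply: le_trans (normc_sum _ _ _) _.
  have := @half_exp_bound (fun j => normc (c (k.+1 + j)%N * z ^+ j)) K 0 m.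
  rewrite expr0 mulr1; apply=> // j; rewrite normcM normcX -/r.
  apply: ler_pM; rewrite ?normc_ge0 ?exprn_ge0 ?(ltW r0) //.
  by rewrite lerXn2r ?nnegrE ?invr_ge0 ?ler0n ?(ltW r0).
have -> : psum c z n = z ^+ k * (c k + z * \sum_(j < n - k.+1) c (k.+1 + j)%N * z ^+ j).
  rewrite -{1}(subnKC kn) /psum big_split_ord /= big_ord_recr /= big1 ?add0r; last first.
    by move=> j _; rewrite IH ?mul0r.
  rewrite mulrDr mulrC; congr (_ + _); rewrite !mulr_sumr; apply: eq_bigr => j _.
  by rewrite exprD exprSr; ring.
rewrite normcM normcX -/r [X in X / 2]mulrC -mulrA ler_wpM2l ?exprn_ge0 ?(ltW r0) //.
move: (tail (n - k.+1)%N); set s := \sum_(j < _) _ => sK.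
have := normcBl (c k) (- (z * s)); rewrite normcN opprK normcM -/r.
have := normc_ge0 s; nra.
Qed.

Lemma entire_eq0 f (e : R) : entire f -> 0 < e ->
  (forall z, z != 0 -> normc z < e -> f z = 0) -> forall z, f z = 0.
Proof.
move=> ef e0 f0 z1; apply/eqP/negPn/negP => fz1.
have [e' e'0 fe'] := entire_isolated_zero ef (ex_intro _ z1 fz1).
have m0 : 0 < Num.min e e' / 2 by rewrite divr_gt0 // lt_min e0.
pose z : C := (Num.min e e' / 2)%:C%C.
have nz : normc z = Num.min e e' / 2 by rewrite normc_real ger0_norm // ltW.
have z0 : z != 0 by rewrite -normc_gt0 nz.
have lt : normc z < Num.min e e' by rewrite nz; lra.
move: lt; rewrite lt_min => /andP[ze ze'].
by have := fe' z z0 ze'; rewrite (f0 z z0 ze) eqxx.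
Qed.

(** The cross products g h' and g' h are entire and agree near 0, hence everywhere. If just one
    denominator vanished at z, this identity would make its own numerator vanish too, against the
    absence of common zeros; if both vanish, both quotients are 0. *)
Lemma meromorphic_unique f f' (e : R) : meromorphic f -> meromorphic f' -> 0 < e ->
  (forall z, z != 0 -> normc z < e -> f z = f' z) -> f = f'.
Proof.
move=> [g [h [eg eh h0 gh fE]]] [g' [h' [eg' eh' h'0 gh' fE']]] e0 ff'.
have [r r0 hr] := entire_isolated_zero eh h0.
have [r' r'0 hr'] := entire_isolated_zero eh' h'0.
have cross z : g z * h' z = g' z * h z.
  apply/eqP; rewrite -subr_eq0; apply/eqP.
  apply: (entire_eq0 (e := Num.min e (Num.min r r'))
    (entireB (entireM eg eh') (entireM eg' eh))) => [|{}z z0].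
    by rewrite !lt_min e0 r0.
  rewrite !lt_min => /and3P[ze zr zr']; have := ff' z z0 ze; rewrite fE fE'.
  by move/eqP; rewrite eqr_div ?hr ?hr' // => /eqP ->; rewrite subrr.
apply/funext => z; rewrite fE fE'; have := cross z; have := gh z; have := gh' z.
have [->|hz] := eqVneq (h z) 0; have [->|h'z] := eqVneq (h' z) 0; rewrite ?orbF //.
- by rewrite invr0 !mulr0.
- by move=> _ gz /eqP; rewrite mulr0 mulf_eq0 (negbTE gz) (negbTE h'z).
- by move=> gz _ /esym/eqP; rewrite mulr0 mulf_eq0 (negbTE gz) (negbTE hz).
- by move=> _ _ /eqP; rewrite -eqr_div // => /eqP.
Qed.

End Entire.

(** * The double q-Pochhammer symbol *)

Lemma prod_square_recr (A : comPzSemiRingType) (F : nat -> nat -> A) (n : nat) :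
  \prod_(i < n.+1) \prod_(j < n.+1) F i j =
  (\prod_(i < n) \prod_(j < n) F i j) *
  ((\prod_(i < n) F i n) * \prod_(j < n.+1) F n j).
Proof.
rewrite big_ord_recr /= (eq_bigr (fun i : 'I_n => (\prod_(j < n) F i j) * F i n)).
  by rewrite big_split /= mulrA.
by move=> i _; rewrite big_ord_recr.
Qed.

Section QPochhammer.
Variable R : realType.
Local Notation C := R[i].
Local Notation normc := (@ComplexField.Normc.normc R).
Implicit Types (p : {poly C}) (q : {poly R}) (a b z : C).

(** Majorization of power series: [q] has real coefficients bounding those of [p]. *)
Definition dominated p q := forall k, normc p`_k <= q`_k.

Lemma dominatedM p p' q q' : dominated p q -> dominated p' q' ->
  dominated (p * p') (q * q').
Proof.
move=> pq pq' k; rewrite !coefM; apply: le_trans (normc_sum _ _ _) _.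
by apply: ler_sum => i _; rewrite normcM; apply: ler_pM; rewrite ?normc_ge0.
Qed.

Lemma dominatedD p p' q q' : dominated p q -> dominated p' q' ->
  dominated (p + p') (q + q').
Proof. by move=> pq pq' k; rewrite !coefD; apply: le_trans (normcD _ _) _; exact: lerD. Qed.

(** Majorizing p - 1 by q - 1 controls increments: multiplying partial products P and Q by p and q
    changes them by P (p - 1) and Q (q - 1). *)
Definition dominated1 p q := dominated p q /\ dominated (p - 1) (q - 1).

Lemma dominated1M p p' q q' : dominated1 p q -> dominated1 p' q' ->
  dominated1 (p * p') (q * q').
Proof.
move=> [pq pq1] [pq' pq1']; split; first exact: dominatedM.
rewrite (_ : p * p' - 1 = p * (p' - 1) + (p - 1)); last by ring.
rewrite (_ : q * q' - 1 = q * (q' - 1) + (q - 1)); last by ring.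
by apply: dominatedD => //; exact: dominatedM.
Qed.

Lemma dominated1_prod (n : nat) (F : 'I_n -> {poly C}) (G : 'I_n -> {poly R}) :
  (forall i, dominated1 (F i) (G i)) -> dominated1 (\prod_i F i) (\prod_i G i).
Proof.
move=> FG; elim/big_rec2: _ => [|i q p _ qp]; last exact: dominated1M.
split=> k; last by rewrite !subrr !coef0 ComplexField.Normc.normc0.
by rewrite !coef1 normc_nat.
Qed.

Lemma dominated1_factor (s : C) : dominated1 (1 - s *: 'X) (1 + normc s *: 'X).
Proof.
split=> k.
  rewrite !(coefB, coefD, coefZ, coefX, coef1); apply: le_trans (normcD _ _) _.
  by rewrite normcN normcM !normc_nat.
rewrite addrAC subrr add0r addrAC subrr add0r coefN !coefZ !coefX normcN normcM.
by rewrite normc_nat.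
Qed.

Variables (a b : C).
Hypotheses (a1 : normc a < 1) (b1 : normc b < 1).

Let S := ((1 - normc a) * (1 - normc b))^-1.
Let P N : {poly C} := \prod_(i < N) \prod_(j < N) (1 - (a ^+ i * b ^+ j) *: 'X).
Let Q N : {poly R} := \prod_(i < N) \prod_(j < N) (1 + normc (a ^+ i * b ^+ j) *: 'X).

Let norm_sum N := \sum_(i < N) \sum_(j < N) normc (a ^+ i * b ^+ j).

Let norm_sumE N : norm_sum N = S * ((1 - normc a ^+ N) * (1 - normc b ^+ N)).
Proof.
rewrite /norm_sum (eq_bigr (fun i : 'I_N => normc a ^+ i * \sum_(j < N) normc b ^+ j)).
  by rewrite -mulr_suml !geometric_sumE ?lt_eqF // /S invfM; ring.
by move=> i _; rewrite mulr_sumr; apply: eq_bigr => j _; rewrite normcM !normcX.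
Qed.

Let S0 : 0 <= S.
Proof. by rewrite invr_ge0 mulr_ge0 // subr_ge0 ltW. Qed.

Let norm_sum_le N : norm_sum N <= S.
Proof.
rewrite norm_sumE ler_piMr // mulr_ile1 ?subr_ge0 ?gerBl ?exprn_ge0 ?normc_ge0 //.
  by rewrite exprn_ile1 ?normc_ge0 // ltW.
by rewrite exprn_ile1 ?normc_ge0 // ltW.
Qed.

Let PQ N : dominated1 (P N) (Q N).
Proof. by apply: dominated1_prod => i; apply: dominated1_prod => j; exact: dominated1_factor. Qed.

(** By 1 + x <= exp x, the product is at most the exponential of a double geometric sum, bounded
    independently of N. *)
Let Q_le N (rho : R) : 0 <= rho -> (Q N).[rho] <= expR (rho * S).
Proof.
move=> rho0; rewrite horner_prod.
apply: le_trans (_ : expR (rho * norm_sum N) <= _); last first.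
  by rewrite ler_expR ler_wpM2l.
rewrite mulr_sumr expR_sum; apply: ler_prod => i _.
rewrite horner_prod mulr_sumr expR_sum; apply/andP; split.
  by apply: prodr_ge0 => j _; rewrite !hornerE addr_ge0 // mulr_ge0 ?normc_ge0.
apply: ler_prod => j _; rewrite !hornerE addr_ge0 ?mulr_ge0 ?normc_ge0 //=.
by rewrite mulrC; exact: expR_ge1Dx.
Qed.

Let coef_le N k (rho : R) : 0 <= rho -> normc (P N)`_k * rho ^+ k <= expR (rho * S).
Proof.
move=> rho0; apply: le_trans (Q_le N rho0); have [PQN _] := PQ N.
apply: le_trans (_ : (Q N)`_k * rho ^+ k <= _); first by rewrite ler_wpM2r ?exprn_ge0.
by apply: coef_le_horner => // j; apply: le_trans (PQN j); exact: normc_ge0.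
Qed.

Let coef_ccvg k : ccvg (fun N => (P N)`_k).
Proof.
apply: (@ccvg_dominated _ _ (fun N => (Q N)`_k) (expR (1 * S))) => N; last first.
  have [PQN _] := PQ N; apply: le_trans (Q_le N ler01).
  have := @coef_le_horner R (Q N) 1 k ler01; rewrite expr1n mulr1; apply=> j.
  by apply: le_trans (PQN j); exact: normc_ge0.
rewrite -!coefB /P /Q
  (prod_square_recr (fun i j => 1 - (a ^+ i * b ^+ j) *: 'X))
  (prod_square_recr (fun i j => 1 + normc (a ^+ i * b ^+ j) *: 'X)).
(* The factors added when the square of indices grows from N to N + 1; [q] is their majorant. *)
set p := (X in _ * X - _).
pose q : {poly R} := (\prod_(i < N) (1 + normc (a ^+ i * b ^+ N) *: 'X)) *
  \prod_(j < N.+1) (1 + normc (a ^+ N * b ^+ j) *: 'X).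
rewrite -/(P N) -/(Q N) -/q.
have [_ pq] : dominated1 p q.
  by apply: dominated1M; apply: dominated1_prod => i; exact: dominated1_factor.
have [PQN _] := PQ N.
have := dominatedM PQN pq; rewrite !mulrBr !mulr1; exact.
Qed.

(** Convergence at every z, beyond the disc of [ccv_qpoch2_cexp]: this is what continues the
    contraction of Phi and Psi*. *)
Lemma qpoch2_limit : entire (fun z => qpoch2 z a b) /\
  forall z, ccv (fun k => \prod_(i < k) \prod_(j < k) (1 - z * a ^+ i * b ^+ j))
    (qpoch2 z a b).
Proof.
have [|k|rc Pc] := @ccv_poly_limit R P (fun k => clim (fun N => (P N)`_k)).
- by move=> rho rho0; exists (expR (rho * S)) => N k; exact: coef_le.
- exact: ccvgP (coef_ccvg k).
have PE z : (fun N => (P N).[z]) =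
    fun k => \prod_(i < k) \prod_(j < k) (1 - z * a ^+ i * b ^+ j).
  apply/funext => N; rewrite /P horner_prod; apply: eq_bigr => i _.
  by rewrite horner_prod; apply: eq_bigr => j _; rewrite !hornerE mulrC mulrA.
have qE z : qpoch2 z a b = clim (psum (fun k => clim (fun N => (P N)`_k)) z).
  by have := Pc z; rewrite PE => /ccv_lim.
split; last by move=> z; rewrite qE -PE.
by apply/entireP; exists (fun k => clim (fun N => (P N)`_k)).
Qed.

(** A limit of nonzero products could still be 0. By Weierstrass' inequality the factors outside a
    large enough square of side n have a product of norm at least 1/2, so later partial products
    stay above half of the n-th one. *)
Lemma qpoch2_neq0 z : (forall i j, 1 - z * a ^+ i * b ^+ j != 0) -> qpoch2 z a b != 0.
Proof.
move=> z0; have [_ /(_ z) cz] := qpoch2_limit.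
pose F N := \prod_(i < N) \prod_(j < N) (1 - z * a ^+ i * b ^+ j).
have [n small] : exists n, forall N, normc z * (norm_sum N - norm_sum n) <= 2^-1.
  have sS : (fun N => norm_sum N) @ \oo --> S.
    under eq_fun do rewrite norm_sumE.
    have a0 : (fun n => normc a ^+ n) @ \oo --> (0 : R) by apply: ccv_expr0; rewrite normc_ge0.
    have b0 : (fun n => normc b ^+ n) @ \oo --> (0 : R) by apply: ccv_expr0; rewrite normc_ge0.
    have a1' : (fun n => 1 - normc a ^+ n) @ \oo --> (1 : R).
      by rewrite -[X in _ --> X]subr0; apply: cvgB; [exact: cvg_cst|exact: a0].
    have b1' : (fun n => 1 - normc b ^+ n) @ \oo --> (1 : R).
      by rewrite -[X in _ --> X]subr0; apply: cvgB; [exact: cvg_cst|exact: b0].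
    have := @cvgM R nat \oo _ (fun=> S) _ _ _ (@cvg_cst _ S _ _ _) (cvgM a1' b1').
    by rewrite !mulr1; apply.
  have z1 : 0 < 2 * (normc z + 1) by have := normc_ge0 z; lra.
  (* The sums increase to S, so this n leaves at most 1 / (2 (|z| + 1)); adding 1 avoids dividing by
     0 at z = 0. *)
  have /cvgrPdist_lt/(_ (2 * (normc z + 1))^-1) := sS.
  case=> [|n _ /(_ n (leqnn n)) /=]; first by rewrite invr_gt0.
  move=> /ltr_normlW; rewrite -[X in _ < X]mul1r ltr_pdivlMr // => Sn.
  exists n => N; have := norm_sum_le N; have := norm_sum_le n; have := normc_ge0 z.
  nra.
have bound N : (n <= N)%N -> normc (F n) / 2 <= normc (F N).
  move=> nN; rewrite /F.
  pose B (i j : 'I_N) := (i < n)%N && (j < n)%N.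
  have FN : F N = F n * \prod_(ij : 'I_N * 'I_N | ~~ B ij.1 ij.2) (1 - z * a ^+ ij.1 * b ^+ ij.2).
    rewrite /F pair_bigA /= (bigID (fun ij : 'I_N * 'I_N => B ij.1 ij.2)) /=; congr (_ * _).
    rewrite -(pair_big (fun i : 'I_N => (i < n)%N) (fun j : 'I_N => (j < n)%N)
      (fun i j : 'I_N => 1 - z * a ^+ i * b ^+ j)) /=.
    rewrite (big_ord_widen_cond _ predT (fun i => \prod_(j < n) (1 - z * a ^+ i * b ^+ j)) nN).
    apply: eq_bigr => i _.
    by rewrite (big_ord_widen_cond _ predT (fun j => 1 - z * a ^+ i * b ^+ j) nN).
  have SN : norm_sum N - norm_sum n =
      \sum_(ij : 'I_N * 'I_N | ~~ B ij.1 ij.2) normc (a ^+ ij.1 * b ^+ ij.2).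
    rewrite /norm_sum pair_bigA /= (bigID (fun ij : 'I_N * 'I_N => B ij.1 ij.2)) /=.
    rewrite -(pair_big (fun i : 'I_N => (i < n)%N) (fun j : 'I_N => (j < n)%N)
      (fun i j : 'I_N => normc (a ^+ i * b ^+ j))) /=.
    rewrite (big_ord_widen_cond _ predT (fun i => \sum_(j < n) normc (a ^+ i * b ^+ j)) nN).
    rewrite [X in X + _ - _](_ : _ = \sum_(i < N | (i < n)%N) \sum_(j < n) normc (a ^+ i * b ^+ j)).
      by rewrite addrAC subrr add0r.
    apply: eq_bigr => i _.
    by rewrite (big_ord_widen_cond _ predT (fun j => normc (a ^+ i * b ^+ j)) nN).
  rewrite -/(F n) -/(F N) FN normcM ler_wpM2l ?normc_ge0 // normc_prod.
  apply: le_trans (_ : 1 - \sum_(ij : 'I_N * 'I_N | ~~ B ij.1 ij.2)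
     normc (z * a ^+ ij.1 * b ^+ ij.2) <= _); last exact: prod_normc_ge.
  under eq_bigr do rewrite -mulrA normcM.
  by rewrite -mulr_sumr -SN; have := small N; lra.
rewrite -normc_gt0; apply: lt_le_trans (ccv_norm_ge cz bound).
rewrite divr_gt0 // normc_gt0 /F; apply/prodf_neq0 => i _; apply/prodf_neq0 => j _.
exact: z0.
Qed.

End QPochhammer.

(** * Contractions of the currents *)

Section ModeExponentials.
Variable R : realType.
Local Notation C := R[i].
Local Notation normc := (@ComplexField.Normc.normc R).
Implicit Types (f g : nat -> C) (x y z w : C).

(** Convergence is kept with the value because [modesum] is additive only on convergent sums. *)
Definition modes_exp f x := ccvg (modes f) /\ cexp (modesum f) = x.

Lemma modes_exp_eq f g x : (forall m, (0 < m)%N -> f m = g m) ->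
  modes_exp f x -> modes_exp g x.
Proof.
move=> fg; rewrite /modes_exp (eq_modesum fg) (_ : modes f = modes g) //.
by apply/funext => M; apply: eq_big_nat => m /andP[m0 _]; exact: fg.
Qed.

Lemma modes_expD f g x y : modes_exp f x -> modes_exp g y ->
  modes_exp (fun m => f m + g m) (x * y).
Proof.
by move=> [cf <-] [cg <-]; split; [exact: ccvg_modesD|rewrite modesumD // cexpD].
Qed.

Lemma modes_expN f x : modes_exp f x -> modes_exp (fun m => - f m) x^-1.
Proof.
move=> [cf <-]; have fN : (fun m => - f m) = (fun m => -1 * f m).
  by apply/funext => m; rewrite mulN1r.
split; last by rewrite fN modesumZ // mulN1r cexpN.
rewrite (_ : modes _ = fun M => -1 * modes f M).
  exact: ccv_ccvg (ccvZ _ (ccv_modesum cf)).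
by apply/funext => M; rewrite fN /modes mulr_sumr.
Qed.

Lemma modes_exp_log x : normc x < 1 -> modes_exp (fun m => - (x ^+ m / m%:R)) (1 - x).
Proof.
move=> x1; rewrite -[1 - x]invrK; apply: modes_expN; split.
  have x01 : 0 <= normc x < 1 by rewrite normc_ge0.
  by apply: (ccvg_modes x01 (K := 1)) => m m0; rewrite mul1r; exact: normc_expn_div.
by rewrite -cexp_log // cexpN invrK.
Qed.

Lemma modes_exp_qpoch2 x y z : normc x < 1 -> normc y < 1 -> normc z < 1 ->
  modes_exp (fun m => x ^+ m / (m%:R * ((1 - y ^+ m) * (1 - z ^+ m)))) (qpoch2 x y z)^-1.
Proof.
move=> x1 y1 z1; split.
  have x01 : 0 <= normc x < 1 by rewrite normc_ge0.
  by apply: (ccvg_modes x01) => m m0; exact: normc_modes_weight.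
have -> : qpoch2 x y z = _ := ccv_lim (ccv_qpoch2_cexp x1 y1 z1).
by rewrite cexpN invrK.
Qed.

Lemma meromorphic_ratio (g h : C -> C) : entire g -> entire h ->
  (exists z, h z != 0) -> (forall z, h z = 0 -> g z != 0) ->
  meromorphic (fun z => g z / h z).
Proof.
move=> eg eh h0 gh; exists g, h; split=> // z.
by rewrite orbC; case: eqVneq => //= /gh.
Qed.

Lemma entire_linear a b : entire (fun z => a + b * z).
Proof.
rewrite (_ : (fun z => _) = fun z => (a%:P + b *: 'X).[z]); first exact: entire_poly.
by apply/funext => z; rewrite !hornerE.
Qed.

End ModeExponentials.

(** * Evaluation of the mixed contractions *)

Section Contractions.
Variables (R : realType) (A : params R).
Local Notation C := R[i].
Local Notation normc := (@ComplexField.Normc.normc R).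
Hypothesis gen : generic A.
Local Notation q1 := (r1 A).
Local Notation q2 := (r2 A).
Local Notation hb := (hbarh A).

Lemma r1_neq0 : q1 != 0.
Proof. by have [[]] := gen; rewrite /t1 expf_eq0. Qed.

Lemma r2_neq0 : q2 != 0.
Proof. by have [[_]] := gen; rewrite /t2 expf_eq0. Qed.

Lemma hbarh_neq0 : hb != 0.
Proof. by rewrite mulf_neq0 ?r1_neq0 ?r2_neq0. Qed.

Lemma hbarE : hbar A = hb ^+ 2.
Proof. by rewrite /hbar /t1 /t2 /hbarh exprMn. Qed.

Lemma normc_t1 : normc (t1 A) < 1.
Proof. by have [_ []] := gen => /normc_lt1. Qed.

Lemma normc_t2 : normc (t2 A) < 1.
Proof. by have [_ []] := gen => _ /normc_lt1. Qed.

Lemma normc_hbar : normc (hbar A) < 1.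
Proof. by rewrite normcM mulr_ilt1 ?normc_ge0 ?normc_t1 ?normc_t2. Qed.

Lemma normc_hbarh : normc hb < 1.
Proof. by have := normc_hbar; rewrite hbarE normcX expr_lt1 ?normc_ge0. Qed.

(** Expressed through the m-th powers of [r1], [r2] and [pp], the identities in mode m become
    rational identities within reach of [field]. *)
Lemma mode_powers (m : nat) :
  [/\ t1 A ^+ m = (q1 ^+ m) ^+ 2, t2 A ^+ m = (q2 ^+ m) ^+ 2,
      hbar A ^+ m = (q1 ^+ m) ^+ 2 * (q2 ^+ m) ^+ 2, hb ^+ m = q1 ^+ m * q2 ^+ m
    & pstar A ^+ m = pp A ^+ m / ((q1 ^+ m) ^+ 2 * (q2 ^+ m) ^+ 2)].
Proof.
have sq (x : C) : (x ^+ 2) ^+ m = (x ^+ m) ^+ 2 by rewrite -!exprM mulnC.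
by rewrite /pstar /hbar /t1 /t2 /hbarh expr_div_n [(_ ^+ 2 * _) ^+ m]exprMn
  [(q1 * q2) ^+ m]exprMn !sq.
Qed.

Lemma mode_neq0 (m : nat) : (0 < m)%N ->
  [/\ 1 - (q1 ^+ m) ^+ 2 != 0, 1 - (q2 ^+ m) ^+ 2 != 0,
      1 - (q1 ^+ m) ^+ 2 * (q2 ^+ m) ^+ 2 != 0, 1 - pp A ^+ m != 0
    & 1 - pp A ^+ m / ((q1 ^+ m) ^+ 2 * (q2 ^+ m) ^+ 2) != 0].
Proof.
move=> m0; have [e1 e2 e3 _ e5] := mode_powers m.
have [_ [n1 n2 /normc_lt1 n3 /normc_lt1 n4] _] := gen.
rewrite -e5 -e3 -e1 -e2.
by split; apply: one_subX_neq0; rewrite ?normc_t1 ?normc_t2 ?normc_hbar.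
Qed.

Lemma mode_constants (m : nat) : (0 < m)%N ->
  let Q1 := q1 ^+ m in let Q2 := q2 ^+ m in let P := pp A ^+ m in
  let D := 1 - (Q1 ^+ 2 * Q2 ^+ 2)^-1 in
  [/\ kappa A m = - ((1 - Q1 ^+ 2) * (1 - Q2 ^+ 2) * D),
      heis A m = (1 - Q1 ^+ 2) * (1 - Q2 ^+ 2) * D ^+ 2 / m%:R
        * ((1 - P) / (1 - P / (Q1 ^+ 2 * Q2 ^+ 2))),
      prim A m = (1 - P / (Q1 ^+ 2 * Q2 ^+ 2)) / (1 - P) * (Q1 * Q2)
    & prim A (- m%:Z) = prim A m].
Proof.
move=> m0 Q1 Q2 P D; have [e1 e2 e3 e4 e5] := mode_powers m.
have [n1 n2 n3 n4 n5] := mode_neq0 m0.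
have Q10 : Q1 != 0 by rewrite expf_neq0 // r1_neq0.
have Q20 : Q2 != 0 by rewrite expf_neq0 // r2_neq0.
have P0 : P != 0 by rewrite expf_neq0 //; have [[]] := gen.
have kE : kappa A m = - ((1 - Q1 ^+ 2) * (1 - Q2 ^+ 2) * D).
  by rewrite /kappa -exprnN -!exprnP e1 e2 e3.
have pE : prim A m = (1 - P / (Q1 ^+ 2 * Q2 ^+ 2)) / (1 - P) * (Q1 * Q2).
  by rewrite /prim -!exprnP e4 e5.
split=> //; first by rewrite /heis kE e3 e5 -/P -/Q1 -/Q2 -/D; ring.
rewrite pE /prim -!exprnN e4 e5 -/P -/Q1 -/Q2.
move: n4 n5; rewrite -/P -/Q1 -/Q2.
move: Q1 Q2 P Q10 Q20 P0 {D e1 e2 e3 e4 e5 n1 n2 n3 kE pE} => Q1 Q2 P Q10 Q20 P0 n4 n5.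
have n5' : Q1 ^+ 2 * Q2 ^+ 2 - P != 0.
  apply: contra n5 => /eqP/subr0_eq <-; rewrite divff ?subrr //.
  by rewrite mulf_neq0 ?expf_neq0.
have n4' : P - 1 != 0 by rewrite -opprB oppr_eq0.
by field; rewrite ?Q10 ?Q20 ?P0 ?n4 ?n4' ?n5'.
Qed.

Lemma is_contraction_unique k k' f f' :
  Defs.is_contraction A k k' f -> Defs.is_contraction A k k' f' -> f = f'.
Proof.
move=> [mf [e e0 fe]] [mf' [e' e'0 fe']].
have Re_gt0 (x : C) : 0 < x -> x = (complex.Re x)%:C%C /\ 0 < complex.Re x.
  move=> x0; have xr : (complex.Re x)%:C%C = x by apply: RRe_real; exact: gtr0_real.
  by split=> //; rewrite -ltcR xr.
have [eE er0] := Re_gt0 _ e0; have [e'E e'r0] := Re_gt0 _ e'0.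
apply: (meromorphic_unique (e := Num.min (complex.Re e) (complex.Re e')) mf mf').
  by rewrite lt_min er0.
move=> z z0; rewrite lt_min => /andP[ze ze'].
pose s := State (Sector 0 1 0) (fun=> 1) : state R.
have sf : fock_vector s by split; [exact: oner_neq0|exact: fock_const].
have zE : `|z / 1| < e by rewrite divr1 normr_normc eE ltcR.
have zE' : `|z / 1| < e' by rewrite divr1 normr_normc e'E ltcR.
have fin0 : finsupp (fun=> 0 : C) by exists 0%N.
have [_ /(_ _ fin0)] := fe 1 z (oner_neq0 _) z0 zE s sf.
have [_ /(_ _ fin0) ->] := fe' 1 z (oner_neq0 _) z0 zE' s sf.
rewrite /scale /= divr1 exp1rz expr0z !mulr1 !mul1r => /esym e1; apply: mulIf e1.
exact: cexp_neq0.
Qed.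

Lemma contractionE k k' f : Defs.is_contraction A k k' f -> Defs.contraction A k k' = f.
Proof.
move=> cf; apply: (is_contraction_unique _ cf).
by apply: (xgetPex (fun=> 0 : C)); exists f.
Qed.

Lemma cbase_neq0 k z : z != 0 -> cbase (current A k z) != 0.
Proof.
move=> z0; have hz : hb / z != 0 by rewrite mulf_neq0 ?invr_eq0 ?hbarh_neq0.
by case: k => /=; rewrite ?oner_neq0 // invr_eq0.
Qed.

(* The exponentials commute past each other by Baker-Campbell-Hausdorff,
   the zero modes by [h, alpha] = [c, Lambda_0] = 1. *)
Lemma is_contraction_modes k k' f : meromorphic f ->
  (forall z w, z != 0 -> w != 0 -> normc (w / z) < normc hb -> exists2 x,
     modes_exp (fun m => cre (current A k' w) m * (ann (current A k z) m * heis A m)) x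
   & base (current A k' w) ^ hh (current A k z) *
     cbase (current A k z) ^ lam (current A k' w) * x = f (w / z)) ->
  Defs.is_contraction A k k' f.
Proof.
move=> mf kk'; split=> //; exists (normc hb)%:C%C.
  by rewrite ltcR normc_gt0 hbarh_neq0.
move=> z w z0 w0; rewrite normr_normc ltcR => wz s [eh0 _].
have [x [cx <-] fE] := kk' z w z0 w0 wz; rewrite -fE.
set o := current A k z; set o' := current A k' w.
have co : cbase o != 0 by exact: cbase_neq0.
split.
  rewrite /= /sec_act /=; congr Sector; rewrite -?addrA; first by rewrite [lam o + _]addrC.
    by rewrite -mulrA [base o' * _]mulrC.
  by rewrite [qq o + _]addrC.
move=> a fa; rewrite /scale /act /=.
have -> : (fun m => a m + (ann o m + ann o' m) * heis A m) =
    (fun m => a m + ann o m * heis A m + ann o' m * heis A m).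
  by apply/funext => m; rewrite mulrDl addrA.
have fs (c : nat -> C) : ccvg (modes (fun m => c m * a m)).
  apply: ccvg_modes_finsupp; have [N aN] := fa; exists N => m /aN ->.
  by rewrite mulr0.
have -> : modesum (fun m => cre o' m * (a m + ann o m * heis A m)) =
    modesum (fun m => cre o' m * a m) + modesum (fun m => cre o' m * (ann o m * heis A m)).
  by rewrite -modesumD //; apply: eq_modesum => m _; rewrite mulrDr.
have -> : modesum (fun m => (cre o m + cre o' m) * a m) =
    modesum (fun m => cre o m * a m) + modesum (fun m => cre o' m * a m).
  by rewrite -modesumD //; apply: eq_modesum => m _; rewrite mulrDl.
rewrite !cexpD !expfzMl !expfzDr //.
have alg (b1 b2 b3 b4 b5 b6 b7 b8 b9 b10 : C) :
    b1 * b2 * (b3 * b4) * b5 * (b6 * b7 * (b8 * b9) * b10) =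
    b2 * b4 * b9 * (b1 * b6 * (b3 * b7) * (b5 * b8) * b10) by ring.
exact: alg.
Qed.

Lemma mode_brackets (m : nat) (z w : C) (m0 : (0 < m)%N) (z0 : z != 0) :
  let bracket k k' := cre (current A k' w) m * (ann (current A k z) m * heis A m) in
  let r := w / z in
  [/\ bracket Xminus Xplus = - ((t1 A * (r / hb)) ^+ m / m%:R)
        + - ((t2 A * (r / hb)) ^+ m / m%:R)
        + - (- ((r / hb) ^+ m / m%:R) + - ((hb * r) ^+ m / m%:R)),
      bracket Xplus Xminus = bracket Xminus Xplus &
      [/\ bracket Xminus Psi0 = - ((hb * r) ^+ m / m%:R),
          bracket Xplus Phi0 = - ((hb * r) ^+ m / m%:R),
          bracket Psi0 Xminus = - ((r / hb) ^+ m / m%:R),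
          bracket Phi0 Xplus = - ((r / hb) ^+ m / m%:R) &
      bracket Phi0 Psi0 = (hb * r) ^+ m / (m%:R * ((1 - t1 A ^+ m) * (1 - t2 A ^+ m))) /\
      bracket Psi0 Phi0 = (hb * r) ^+ m / (m%:R * ((1 - t1 A ^+ m) * (1 - t2 A ^+ m)))]].
Proof.
have [e1 e2 e3 e4 e5] := mode_powers m; have [n1 n2 n3 n4 n5] := mode_neq0 m0.
have [kE hE pE pN] := mode_constants m0.
rewrite /= pN hE pE kE e3 [(t1 A * _) ^+ m]exprMn [(t2 A * _) ^+ m]exprMn.
rewrite [(hb * (w / z)) ^+ m]exprMn [(hb * w) ^+ m]exprMn [(hb * z) ^+ m]exprMn.
rewrite !expr_div_n e1 e2 e4.
have Q10 : q1 ^+ m != 0 by rewrite expf_neq0 // r1_neq0.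
have Q20 : q2 ^+ m != 0 by rewrite expf_neq0 // r2_neq0.
have zm0 : z ^+ m != 0 by rewrite expf_neq0.
have M0 : m%:R != 0 :> C by rewrite pnatr_eq0 -lt0n.
move: (q1 ^+ m) (q2 ^+ m) (pp A ^+ m) (w ^+ m) (z ^+ m) (m%:R : C) Q10 Q20 zm0 M0 n1 n2 n3 n4 n5.
move=> {m0 e1 e2 e3 e4 e5 kE hE pE pN} Q1 Q2 P W Z M Q10 Q20 Z0 M0 n1 n2.
rewrite -exprMn => n3 n4 n5.
have n5' : (Q1 * Q2) ^+ 2 - P != 0.
  apply: contra n5 => /eqP/subr0_eq <-; rewrite divff ?subrr //.
  by rewrite expf_neq0 // mulf_neq0.
have n3' : (Q1 * Q2) ^+ 2 - 1 != 0 by rewrite -opprB oppr_eq0.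
have n1' : Q1 ^+ 2 - 1 != 0 by rewrite -opprB oppr_eq0.
have n2' : Q2 ^+ 2 - 1 != 0 by rewrite -opprB oppr_eq0.
have n4' : P - 1 != 0 by rewrite -opprB oppr_eq0.
split; [| |split; last split]; field;
  by rewrite ?Q10 ?Q20 ?Z0 ?M0 ?n1 ?n2 ?n3 ?n4 ?n5' ?n3' ?n1' ?n2' ?n4'.
Qed.

(** The radius |hbar^(1/2)| serves all pairs: r / hbar^(1/2) is the largest ratio whose powers are
    summed. *)
Lemma normc_ratio_bounds r : normc r < normc hb ->
  [/\ normc (r / hb) < 1, normc (t1 A * (r / hb)) < 1, normc (t2 A * (r / hb)) < 1
    & normc (hb * r) < 1].
Proof.
move=> rh; have hb0 : 0 < normc hb by rewrite normc_gt0 hbarh_neq0.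
have r1 : normc (r / hb) < 1 by rewrite normcM ComplexField.Normc.normcV ltr_pdivrMr ?mul1r.
split=> //; rewrite normcM mulr_ilt1 ?normc_ge0 ?normc_t1 ?normc_t2 ?normc_hbarh //.
exact: lt_trans rh normc_hbarh.
Qed.

Definition current_contraction (r : C) : C :=
  (1 - t1 A * (r / hb)) * (1 - t2 A * (r / hb)) / ((1 - r / hb) * (1 - hb * r)).

(** Numerator and denominator are palindromic quadratics, with roots r1/r2, r2/r1 and hb, 1/hb.
    Inversion scales both by r^-2, so the identity holds at the poles as well. *)
Lemma current_contraction_inv r : r != 0 ->
  current_contraction r^-1 = current_contraction r.
Proof.
move=> r0; rewrite /current_contraction.
have -> : t1 A = q1 ^+ 2 by [].
have -> : t2 A = q2 ^+ 2 by [].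
have -> : hb = q1 * q2 by [].
have := r1_neq0; have := r2_neq0; move: q1 q2 => Q1 Q2 Q20 Q10.
have -> : (1 - Q1 ^+ 2 * (r^-1 / (Q1 * Q2))) * (1 - Q2 ^+ 2 * (r^-1 / (Q1 * Q2))) =
    r ^- 2 * ((1 - Q1 ^+ 2 * (r / (Q1 * Q2))) * (1 - Q2 ^+ 2 * (r / (Q1 * Q2)))).
  by field; rewrite r0 Q10 Q20.
have -> : (1 - r^-1 / (Q1 * Q2)) * (1 - Q1 * Q2 * r^-1) =
    r ^- 2 * ((1 - r / (Q1 * Q2)) * (1 - Q1 * Q2 * r)).
  by field; rewrite r0 Q10 Q20.
by rewrite -mulf_div divff ?mul1r // invr_eq0 expf_neq0.
Qed.

(** The poles are hb and 1/hb, where the numerator is (1 - t1) (1 - t2) and (1 - 1/t2) (1 - 1/t1);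
    neither is 0 because |t1|, |t2| < 1. *)
Lemma meromorphic_current_contraction : meromorphic current_contraction.
Proof.
have lin a b : entire (fun z : C => a - b * z).
  by under eq_fun do rewrite -mulNr; exact: entire_linear.
apply: (@meromorphic_ratio _ (fun r => (1 - t1 A * (r / hb)) * (1 - t2 A * (r / hb)))
  (fun r => (1 - r / hb) * (1 - hb * r))).
- under eq_fun do rewrite ![_ / hb]mulrC !mulrA.
  exact: entireM.
- under eq_fun do rewrite [_ / hb]mulrC.
  exact: entireM.
- by exists 0; rewrite mul0r mulr0 subr0 mulr1 oner_neq0.
have ne (t x : C) : normc t < 1 -> t * x = 1 -> normc x > 1.
  move=> t1 /(congr1 normc); rewrite normcM ComplexField.Normc.normc1 => tx.
  have := normc_ge0 x; have := normc_ge0 t; nra.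
move=> r /eqP; rewrite mulf_eq0 !subr_eq0 => /orP[|] /eqP rE.
  have := one_subX_neq0 normc_t1 (ltn0Sn 0); have := one_subX_neq0 normc_t2 (ltn0Sn 0).
  by rewrite !expr1 -rE !mulr1 => h2 h1; rewrite mulf_neq0.
have hb0 := hbarh_neq0; have r0 : r != 0.
  by apply/eqP => r0; move: rE; rewrite r0 mulr0 => /eqP; rewrite oner_eq0.
have hr : hb = r^-1 by apply: (mulIf r0); rewrite -rE mulVf.
have inv : r / hb = (hbar A)^-1.
  by rewrite hbarE hr expr2 invfM !invrK.
have u1 : q1 != 0 := r1_neq0; have u2 : q2 != 0 := r2_neq0.
have e1 : t1 A * (r / hb) = (t2 A)^-1.
  by rewrite inv /hbar invfM mulrA divff ?mul1r // /t1 expf_neq0.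
have e2 : t2 A * (r / hb) = (t1 A)^-1.
  by rewrite inv /hbar invfM mulrCA divff ?mulr1 // /t2 expf_neq0.
have sub1V (t : C) : t != 0 -> normc t < 1 -> 1 - t^-1 != 0.
  move=> t0 t1; rewrite -(mulfV t0) -[X in _ - X]mul1r -mulrBl mulf_neq0 ?invr_eq0 //.
  by have := one_subX_neq0 t1 (ltn0Sn 0); rewrite -opprB oppr_eq0 expr1.
rewrite e1 e2 mulf_neq0 // sub1V ?normc_t1 ?normc_t2 // ?expf_neq0 //.
Qed.

Lemma contraction_currents :
  Defs.contraction A Xminus Xplus = current_contraction /\
  Defs.contraction A Xplus Xminus = current_contraction.
Proof.
have E r : normc r < normc hb -> modes_exp (fun m => - ((t1 A * (r / hb)) ^+ m / m%:R)
        + - ((t2 A * (r / hb)) ^+ m / m%:R)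
        + - (- ((r / hb) ^+ m / m%:R) + - ((hb * r) ^+ m / m%:R))) (current_contraction r).
  move=> /normc_ratio_bounds[h1 h2 h3 h4]; apply: modes_expD.
    by apply: modes_expD; exact: modes_exp_log.
  by apply: modes_expN; apply: modes_expD; exact: modes_exp_log.
split; apply: contractionE; apply: is_contraction_modes meromorphic_current_contraction _;
  move=> z w z0 w0 /E Er;
  (exists (current_contraction (w / z)); last by rewrite /= !exp1rz !expr0z !mul1r).
  by apply: modes_exp_eq Er => m m0; have [->] := mode_brackets w m0 z0.
by apply: modes_exp_eq Er => m m0; have [e1 e2 _] := mode_brackets w m0 z0; rewrite e2 e1.
Qed.

(* [zero_contraction r = 1 - (hb r)^-1], with value 0 at the pole *)
Definition zero_contraction (r : C) : C := (hb * r - 1) / (hb * r).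

Lemma meromorphic_zero_contraction : meromorphic zero_contraction.
Proof.
apply: (@meromorphic_ratio _ (fun r => hb * r - 1) (fun r => hb * r)).
- by under eq_fun do rewrite addrC; exact: entire_linear.
- by under eq_fun do rewrite -[hb * _]add0r; exact: entire_linear.
- by exists 1; rewrite mulr1 hbarh_neq0.
by move=> r ->; rewrite sub0r oppr_eq0 oner_neq0.
Qed.

(** In both cases the zero modes contribute (-w)^-1 (hb/z)^-1 = - z / (hb w). In the opposite order
    they contribute 1, and this asymmetry makes the two orders continuations of each other. *)
Lemma contraction_zero :
  Defs.contraction A Xminus Psi0 = zero_contraction /\
  Defs.contraction A Xplus Phi0 = zero_contraction.
Proof.
have E r : normc r < normc hb -> modes_exp (fun m => - ((hb * r) ^+ m / m%:R)) (1 - hb * r).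
  by move=> /normc_ratio_bounds[_ _ _ h]; exact: modes_exp_log.
split; apply: contractionE; apply: is_contraction_modes meromorphic_zero_contraction _;
  move=> z w z0 w0 /E Er; exists (1 - hb * (w / z)).
- by apply: modes_exp_eq Er => m m0; have [_ _ [->]] := mode_brackets w m0 z0.
- rewrite /= !exprN1 /zero_contraction; field.
  by rewrite z0 w0 hbarh_neq0.
- by apply: modes_exp_eq Er => m m0; have [_ _ [_ ->]] := mode_brackets w m0 z0.
- rewrite /= !expr1z /zero_contraction; field.
  by rewrite z0 w0 hbarh_neq0.
Qed.

Definition linear_contraction (r : C) : C := 1 - r / hb.

Lemma meromorphic_linear_contraction : meromorphic linear_contraction.
Proof.
rewrite (_ : linear_contraction = fun r => (1 + - hb^-1 * r) / (1 + 0 * r)); last first.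
  by apply/funext => r; rewrite mul0r addr0 divr1 mulNr mulrC.
apply: meromorphic_ratio; [exact: entire_linear|exact: entire_linear| |].
  by exists 0; rewrite mulr0 addr0 oner_neq0.
by move=> r /eqP; rewrite mul0r addr0 oner_eq0.
Qed.

Lemma contraction_linear :
  Defs.contraction A Psi0 Xminus = linear_contraction /\
  Defs.contraction A Phi0 Xplus = linear_contraction.
Proof.
have E r : normc r < normc hb -> modes_exp (fun m => - ((r / hb) ^+ m / m%:R)) (1 - r / hb).
  by move=> /normc_ratio_bounds[h _ _ _]; exact: modes_exp_log.
split; apply: contractionE; apply: is_contraction_modes meromorphic_linear_contraction _;
  move=> z w z0 w0 /E Er; exists (1 - w / z / hb); rewrite /= ?expr0z ?exp1rz ?mul1r //.
- by apply: modes_exp_eq Er => m m0; have [_ _ [_ _ ->]] := mode_brackets w m0 z0.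
- by apply: modes_exp_eq Er => m m0; have [_ _ [_ _ _ ->]] := mode_brackets w m0 z0.
Qed.

Definition vertex_contraction (r : C) : C := (qpoch2 (hb * r) (t1 A) (t2 A))^-1.

Lemma meromorphic_vertex_contraction : meromorphic vertex_contraction.
Proof.
have [eq _] := qpoch2_limit normc_t1 normc_t2.
rewrite (_ : vertex_contraction = fun r => (1 + 0 * r) / qpoch2 (hb * r) (t1 A) (t2 A)).
  apply: meromorphic_ratio; [exact: entire_linear|exact: (entire_scale hb eq)| |].
    exists 0; rewrite mulr0; apply: qpoch2_neq0; [exact: normc_t1|exact: normc_t2|].
    by move=> i j; rewrite !mul0r subr0 oner_neq0.
  by move=> r _; rewrite mul0r addr0 oner_neq0.
by apply/funext => r; rewrite mul0r addr0 mul1r.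
Qed.

Lemma contraction_vertex :
  Defs.contraction A Phi0 Psi0 = vertex_contraction /\
  Defs.contraction A Psi0 Phi0 = vertex_contraction.
Proof.
have E r : normc r < normc hb ->
    modes_exp (fun m => (hb * r) ^+ m / (m%:R * ((1 - t1 A ^+ m) * (1 - t2 A ^+ m))))
      (vertex_contraction r).
  move=> /normc_ratio_bounds[_ _ _ h].
  by apply: modes_exp_qpoch2 => //; [exact: normc_t1|exact: normc_t2].
split; apply: contractionE; apply: is_contraction_modes meromorphic_vertex_contraction _;
  move=> z w z0 w0 /E Er; exists (vertex_contraction (w / z)); rewrite /= ?expr0z ?exp1rz ?mul1r //.
- by apply: modes_exp_eq Er => m m0; have [_ _ [_ _ _ _ [->]]] := mode_brackets w m0 z0.
- by apply: modes_exp_eq Er => m m0; have [_ _ [_ _ _ _ [_ ->]]] := mode_brackets w m0 z0.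
Qed.

Lemma linear_zero_contraction r : r != 0 -> linear_contraction r^-1 = zero_contraction r.
Proof.
move=> r0; rewrite /linear_contraction /zero_contraction; field.
by rewrite r0 hbarh_neq0.
Qed.

End Contractions.

(** * Wick products and the exchange relation *)

Section Wick.
Variables (R : realType) (A : params R).
Local Notation C := R[i].
Implicit Types (e : seq (Defs.factor R)) (w : seq (kind * C)) (x : sector R).

Definition cross w w' : C :=
  \prod_(x <- w) \prod_(y <- w') Defs.contraction A x.1 y.1 (y.2 / x.2).

Lemma cross_catl w1 w2 w : cross (w1 ++ w2) w = cross w1 w * cross w2 w.
Proof. by rewrite /cross big_cat. Qed.

Lemma cross_catr w w1 w2 : cross w (w1 ++ w2) = cross w w1 * cross w w2.
Proof. by rewrite /cross -big_split; apply: eq_bigr => x _; rewrite big_cat. Qed.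

Lemma currents_cat e e' : currents (e ++ e') = currents e ++ currents e'.
Proof. by rewrite /currents map_cat flatten_cat. Qed.

Lemma wick_cat e e' : wick A (e ++ e') = wick A e * wick A e' * cross (currents e) (currents e').
Proof.
elim: e => [|[g|w] e IH] /=; rewrite ?mul1r.
- by rewrite [cross _ _]big_nil mulr1.
- exact: IH.
rewrite IH -!/(cross _ _) currents_cat cross_catr.
rewrite [cross (_ ++ _) _]cross_catl; ring.
Qed.

Lemma nop_eq (o o' : nop R) : cre o = cre o' -> base o = base o' -> lam o = lam o' ->
  qq o = qq o' -> ann o = ann o' -> hh o = hh o' -> cbase o = cbase o' -> o = o'.
Proof.
by case: o => ? ? ? ? ? ? ?; case: o' => ? ? ? ? ? ? ? /= -> -> -> -> -> -> ->.
Qed.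

Lemma nmulC (o o' : nop R) : nmul o o' = nmul o' o.
Proof.
by apply: nop_eq; rewrite /= 1?mulrC 1?addrC //; apply/funext => m; rewrite addrC.
Qed.

Lemma nmulA (o1 o2 o3 : nop R) : nmul o1 (nmul o2 o3) = nmul (nmul o1 o2) o3.
Proof.
by apply: nop_eq; rewrite /= ?mulrA ?addrA //; apply/funext => m; rewrite addrA.
Qed.

Lemma nmul1 (o : nop R) : nmul (nid R) o = o.
Proof.
by apply: nop_eq; rewrite /= ?mul1r ?add0r //; apply/funext => m; rewrite add0r.
Qed.

Lemma nprod_cat w w' : nprod A (w ++ w') = nmul (nprod A w) (nprod A w').
Proof. by elim: w => [|x w IH] /=; rewrite ?nmul1 // IH nmulA. Qed.

Lemma nprod_catC w w' : nprod A (w ++ w') = nprod A (w' ++ w).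
Proof. by rewrite !nprod_cat nmulC. Qed.

Lemma sec_act_nmul (o o' : nop R) x : sec_act (nmul o o') x = sec_act o (sec_act o' x).
Proof.
rewrite /sec_act /=; congr Sector; rewrite -?addrA -?mulrA.
- by rewrite [lam o + _]addrC.
- by rewrite [base o * _]mulrC.
- by rewrite [qq o + _]addrC.
Qed.

Lemma zero_modes_cat e e' x : zero_modes A (e ++ e') x =
  zero_modes A e (sec_act (nprod A (currents e')) x) * zero_modes A e' x.
Proof.
elim: e => [|[g|w] e IH] /=; rewrite ?mul1r // IH mulrA.
by rewrite currents_cat nprod_cat sec_act_nmul.
Qed.

Lemma sec_apply_cat e e' (s : state R) : sec (Defs.apply A (e ++ e') s) =
  sec_act (nprod A (currents e)) (sec_act (nprod A (currents e')) (sec s)).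
Proof. by rewrite -sec_act_nmul -nprod_cat -currents_cat. Qed.

(** Contractions within [e] and within [e'] occur in both orders and normal ordered products
    commute; so only the cross contractions and the shifts of one factor's zero modes by the other
    can differ. *)
Lemma apply_catC e e' (s : state R) (k : C) :
  cross (currents e) (currents e') = k * cross (currents e') (currents e) ->
  zero_modes A e (sec_act (nprod A (currents e')) (sec s)) = zero_modes A e (sec s) ->
  zero_modes A e' (sec_act (nprod A (currents e)) (sec s)) = zero_modes A e' (sec s) ->
  Defs.apply A (e ++ e') s = scale k (Defs.apply A (e' ++ e) s).
Proof.
move=> ck ze ze'; rewrite /Defs.apply !wick_cat !zero_modes_cat ze ze' ck.
rewrite !currents_cat (nprod_catC (currents e)).
have alg (w w' x z z' y : C) :
    w * w' * (k * x) * (z * z') * y = k * (w' * w * x * (z' * z) * y) by ring.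
by rewrite /scale /=; congr State; apply/funext => a; exact: alg.
Qed.

End Wick.

(** Meant for x^+ and x^-, which contain neither Lambda_0 nor alpha nor Q. *)
Lemma sec_act_currents (R : realType) (A : params R) (k : kind) (I : Type)
    (s : seq I) (x : I -> R[i]) (sigma : sector R) :
  (forall z, sec_act (current A k z) sigma = sigma) ->
  sec_act (nprod A [seq (k, x a) | a <- s]) sigma = sigma.
Proof.
move=> ks; elim: s => [|a s IH] /=; last by rewrite sec_act_nmul IH.
by rewrite /sec_act /= !addr0 mulr1; case: (sigma).
Qed.

(** Psi* lowers c and the exponent of e^Q by 1 each, so P - c is preserved. *)
Lemma zh_Psi0 (R : realType) (A : params R) (v : R[i]) (sigma : sector R) :
  zh A (sec_act (current A Psi0 v) sigma) = zh A sigma.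
Proof. by rewrite /zh /=; congr (_ * _ ^ _); ring. Qed.

(** * Complex integrals over product cycles *)

Definition cintegral (R : realType) d (T : measurableType d)
    (mu : {measure set T -> \bar R}) (F : T -> R[i]) : R[i] :=
  if `[< mu.-integrable setT (fun w => (complex.Re (F w))%:E) /\
         mu.-integrable setT (fun w => (complex.Im (F w))%:E) >]
  then (Rintegral mu setT (fun w => complex.Re (F w))
    +i* Rintegral mu setT (fun w => complex.Im (F w)))%C else 0.

(** Multiplying by k or by its inverse preserves integrability, so the default value 0 is taken on
    both sides or on neither. *)
Lemma cintegralZ (R : realType) d (T : measurableType d)
    (mu : {measure set T -> \bar R}) (k : R[i]) (G : T -> R[i]) :
  k != 0 -> cintegral mu (fun w => k * G w) = k * cintegral mu G.
Proof.
move=> k0; rewrite /cintegral.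
have lin (H : T -> R[i]) (c : R[i]) :
    mu.-integrable setT (fun w => (complex.Re (H w))%:E) /\
    mu.-integrable setT (fun w => (complex.Im (H w))%:E) ->
    mu.-integrable setT (fun w => (complex.Re (c * H w))%:E) /\
    mu.-integrable setT (fun w => (complex.Im (c * H w))%:E).
  move=> [hr hi]; split.
    under eq_fun do rewrite cReM EFinB !EFinM.
    by apply: integrableB => //; exact: integrableZl.
  under eq_fun do rewrite cImM EFinD !EFinM.
  by apply: integrableD => //; exact: integrableZl.
have Z (h : T -> R) (c : R) : mu.-integrable setT (fun w => (h w)%:E) ->
    mu.-integrable setT (EFin \o (fun w => c * h w)).
  by move=> ih; rewrite /comp; under eq_fun do rewrite EFinM; exact: integrableZl.
case: asboolP => [iF|niF]; case: asboolP => [iG|niG].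
- have [gr gi] := iG.
  rewrite (_ : (fun w => complex.Re (k * G w)) = fun w =>
    complex.Re k * complex.Re (G w) - complex.Im k * complex.Im (G w)); last first.
    by apply/funext => w; rewrite cReM.
  rewrite (_ : (fun w => complex.Im (k * G w)) = fun w =>
    complex.Re k * complex.Im (G w) + complex.Im k * complex.Re (G w)); last first.
    by apply/funext => w; rewrite cImM.
  rewrite RintegralB ?RintegralD ?RintegralZl //; try exact: Z.
  by case: (k).
- exfalso; apply: niG; have [hr hi] := lin _ k^-1 iF.
  have kK w : k^-1 * (k * G w) = G w by rewrite mulKf.
  by split; [move: hr|move: hi]; under eq_fun do rewrite kK.
- by exfalso; apply: niF; exact: lin iG.
- by rewrite mulr0.
Qed.

Lemma cint2Z (R : realType) (n n' : nat) (C1 : integration_cycle R n)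
    (C2 : integration_cycle R n') (k : R[i]) (f g : ('I_n -> R[i]) -> ('I_n' -> R[i]) -> R[i]) :
  k != 0 -> (forall x y, (forall a, x a != 0) -> (forall b, y b != 0) -> f x y = k * g x y) ->
  cint2 C1 C2 f = k * cint2 C1 C2 g.
Proof.
move=> k0 fg.
have cE h : cint2 C1 C2 h = cintegral (meas C1 \x meas C2)%E
    (fun w => h (pt w.1) (pt w.2) * (jac w.1 * jac w.2)) by [].
rewrite !cE -cintegralZ //; congr cintegral; apply/funext => w.
by rewrite fg ?mulrA // => a; exact: pt_neq0.
Qed.

(** * The factor chi and the exchange of integrands *)

Section Exchange.
Variables (R : realType) (A : params R) (gen : generic A).
Local Notation C := R[i].
Local Notation hb := (hbarh A).

(** Since hbar / (hb u/v) = hb v/u, chi(u/v) is the quotient of the double products at hb u/v and hb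
    v/u. Regularity keeps both nonzero, so the cancellation is genuine and not an effect of division
    by 0. *)
Lemma chi_exchange u v : u != 0 -> v != 0 -> chi_regular A (u / v) ->
  chi A (u / v) != 0 /\
  vertex_contraction A (v / u) = chi A (u / v) * vertex_contraction A (u / v).
Proof.
move=> u0 v0 reg; have hb0 := hbarh_neq0 gen.
have q1 : qpoch2 (hb * (u / v)) (t1 A) (t2 A) != 0.
  apply: qpoch2_neq0; [exact: normc_t1|exact: normc_t2|] => i j.
  by have [h _] := reg i j; rewrite subr_eq0 eq_sym.
have q2 : qpoch2 (hb * (v / u)) (t1 A) (t2 A) != 0.
  apply: qpoch2_neq0; [exact: normc_t1|exact: normc_t2|] => i j.
  by have [_ h] := reg i j; rewrite subr_eq0 eq_sym -[v / u]invf_div.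
have e : t1 A * t2 A / (hb * (u / v)) = hb * (v / u).
  by rewrite -/(hbar A) (hbarE A); field; rewrite u0 v0 hb0.
rewrite /chi /Gam e invf_div; split; first by rewrite mulf_neq0 ?invr_eq0.
rewrite /vertex_contraction; move: q1 q2; move: (qpoch2 _ _ _) (qpoch2 _ _ _) => a b a0 b0.
by rewrite mulrAC divff ?mul1r.
Qed.

Lemma chi_inversion z : z != 0 -> chi A z = Gam (hb / z) (t1 A) (t2 A).
Proof.
move=> z0; have hb0 := hbarh_neq0 gen.
have e1 : t1 A * t2 A / (hb * z) = hb / z.
  by rewrite -/(hbar A) (hbarE A); field; rewrite z0 hb0.
have e2 : t1 A * t2 A / (hb / z) = hb * z.
  by rewrite -/(hbar A) (hbarE A); field; rewrite z0 hb0.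
by rewrite /chi /Gam e1 e2 invf_div.
Qed.

(** Of the four blocks of contractions, the three involving integration variables are symmetric
    under inversion of the ratio; the block of Phi and Psi* alone yields chi. *)
Lemma cross_exchange (I J : Type) (s : seq I) (r : seq J) (x : I -> C) (y : J -> C) (u v : C) :
  (forall a, x a != 0) -> (forall b, y b != 0) -> u != 0 -> v != 0 ->
  chi_regular A (u / v) ->
  let w := [seq (Xminus, x a) | a <- s] ++ [:: (Phi0, u)] in
  let w' := [seq (Xplus, y b) | b <- r] ++ [:: (Psi0, v)] in
  cross A w w' = chi A (u / v) * cross A w' w.
Proof.
move=> x0 y0 u0 v0 reg w w'; have [_ chiE] := chi_exchange u0 v0 reg.
have [c1 c2] := contraction_currents gen; have [c3 c4] := contraction_zero gen.
have [c5 c6] := contraction_linear gen; have [c7 c8] := contraction_vertex gen.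
rewrite /w /w' !cross_catl !cross_catr /cross !big_seq1 /= c7 c8 chiE !big_map.
have -> : \prod_(a <- s) \prod_(p <- [seq (Xplus, y b) | b <- r])
     Defs.contraction A (Xminus, x a).1 p.1 (p.2 / (Xminus, x a).2) =
   \prod_(b <- r) \prod_(p <- [seq (Xminus, x a) | a <- s])
     Defs.contraction A (Xplus, y b).1 p.1 (p.2 / (Xplus, y b).2).
  under eq_bigr do rewrite big_map; under [RHS]eq_bigr do rewrite big_map.
  rewrite exchange_big; apply: eq_bigr => b _; apply: eq_bigr => a _ /=.
  rewrite c1 c2 -[x a / y b]invf_div current_contraction_inv //.
  by rewrite mulf_neq0 ?invr_eq0.
have -> : \prod_(a <- s) \prod_(p <- [:: (Psi0, v)])
     Defs.contraction A (Xminus, x a).1 p.1 (p.2 / (Xminus, x a).2) =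
   \prod_(a <- s) Defs.contraction A Psi0 Xminus (x a / v).
  apply: eq_bigr => a _; rewrite big_seq1 /= c3 c5 -[x a / v]invf_div.
  by rewrite linear_zero_contraction // mulf_neq0 ?invr_eq0.
have -> : \prod_(b <- r) \prod_(p <- [:: (Phi0, u)])
     Defs.contraction A (Xplus, y b).1 p.1 (p.2 / (Xplus, y b).2) =
   \prod_(b <- r) Defs.contraction A Phi0 Xplus (y b / u).
  apply: eq_bigr => b _; rewrite big_seq1 /= c4 c6 -[y b / u]invf_div.
  by rewrite linear_zero_contraction // mulf_neq0 ?invr_eq0.
ring.
Qed.

End Exchange.

Theorem proposition6p4 (R : realType) (A : params R) (gen : generic A)
    (n : nat) (la mu : seq nat)
    (la_n : is_partition n la) (mu_n : is_partition n mu)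
    (C1 C2 : integration_cycle R n) (u v : R[i]) (u_neq0 : u != 0) (v_neq0 : v != 0)
    (uv_regular : chi_regular A (u / v))
    (s : state R) (s_fock : fock_vector s) :
  let PhiPsi x y :=
    apply A (Phi_integrand A la u x ++ Psi_integrand A mu v y) s in
  let PsiPhi x y :=
    apply A (Psi_integrand A mu v y ++ Phi_integrand A la u x) s in
  [/\ forall x y x' y', sec (PhiPsi x y) = sec (PsiPhi x' y'),
      forall a, finsupp a ->
        cint2 C1 C2 (fun x y => vec (PhiPsi x y) a)
        = chi A (u / v) * cint2 C1 C2 (fun x y => vec (PsiPhi x y) a)
    & forall z, z != 0 ->
        chi A z = (Gam (hbarh A * z) (t1 A) (t2 A))^-1
        /\ chi A z = Gam (hbarh A / z) (t1 A) (t2 A)].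
Proof.
move=> PhiPsi PsiPhi.
pose wPhi x := [seq (Xminus, x a) | a <- enum 'I_n] ++ [:: (Phi0, u)] : seq (kind * R[i]).
pose wPsi y := [seq (Xplus, y a) | a <- enum 'I_n] ++ [:: (Psi0, v)] : seq (kind * R[i]).
have cPhi x : currents (Phi_integrand A la u x) = wPhi x by [].
have cPsi y : currents (Psi_integrand A mu v y) = wPsi y by [].
have act0 (k : kind) x sigma : lam (current A k x) = 0 -> qq (current A k x) = 0 ->
    base (current A k x) = 1 -> sec_act (current A k x) sigma = sigma.
  by move=> l0 q0 b0; rewrite /sec_act l0 q0 b0 !addr0 mulr1; case: sigma.
have sPhi x sigma : sec_act (nprod A (wPhi x)) sigma = sec_act (current A Phi0 u) sigma.
  rewrite nprod_catC nprod_cat sec_act_nmul sec_act_currents => [|z]; last exact: act0.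
  by rewrite /= nmulC nmul1.
have sPsi y sigma : sec_act (nprod A (wPsi y)) sigma = sec_act (current A Psi0 v) sigma.
  rewrite nprod_catC nprod_cat sec_act_nmul sec_act_currents => [|z]; last exact: act0.
  by rewrite /= nmulC nmul1.
split; last by move=> z z0; split=> //; exact: chi_inversion.
  move=> x y x' y'; rewrite /PhiPsi /PsiPhi !sec_apply_cat !cPhi !cPsi !sPhi !sPsi.
  by rewrite -!sec_act_nmul nmulC.
move=> a fa; have [chi0 _] := chi_exchange gen u_neq0 v_neq0 uv_regular.
apply: (@cint2Z R n n C1 C2 _ (fun x y => vec (PhiPsi x y) a)
  (fun x y => vec (PsiPhi x y) a) chi0) => x y x0 y0.
(* The states are proportional at each point with nonzero coordinates, so no cycle has to be
   deformed. *)
suff -> : PhiPsi x y = scale (chi A (u / v)) (PsiPhi x y) by [].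
apply: apply_catC.
- by rewrite cPhi cPsi; exact: cross_exchange.
(* The stable envelope in Phi sees the sector only through [zh], which Psi* preserves; the one in
   Psi* sees it only through [zstarh], which Phi preserves as it contains no Q. *)
- have act_nid sigma : sec_act (nid R) sigma = sigma.
    by rewrite /sec_act /= !addr0 mulr1; case: sigma.
  by rewrite cPsi sPsi /= !act_nid zh_Psi0.
- by rewrite cPhi sPhi /= /zstarh /= addr0.
Qed.
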